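(* Let $(\Omega,d,\mu)$ be a doubling metric measure space with doubling constant $C_\mu$ and upper dimension $Q=\log_2C_\mu$. Let $0<\alpha\le1$ and let $X$ be an $\alpha$-convex q.r.i. space on $\Omega$. The following statements are equivalent: (1) The non-collapsing condition holds: there is a constant $b>0$ with $\inf_{x\in\Omega}\mu(B(x,1))=b$. (2) Let $0<q\le\infty$ and $0<s<1$. Then there is a positive constant $C=C(C_\mu,\alpha,q)$ such that for every $f\in L^\alpha(\Omega)+L^\infty(\Omega)$, $$\left(\int_0^1\left(O(|f|^\alpha,t)^{1/\alpha}\,\frac{\phi_X(t)}{t^{s/Q}}\right)^q\frac{dt}t\right)^{1/q}\le C\left(\|f\|_{\dot B^s_{X,q}}+\|f\|_{L^\alpha+L^\infty}\right)$$ (with the usual modification when $q=\infty$).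
   Context: Doubling metric measure space: $(\Omega,d)$ is a metric space, $B(x,r)=\{y\in\Omega: d(x,y)<r\}$, and $\mu$ is a Borel measure with $0<\mu(B)<\infty$ for every ball $B$, such that for some $C>1$ one has $\mu(B(x,2r))\le C\mu(B(x,r))$ for all $x\in\Omega$, $r>0$; the smallest such $C$ is the doubling constant $C_\mu$, and $Q=\log_2C_\mu$ is the upper dimension. Standing assumptions: $\mu(\Omega)=\infty$ and $\mu(\{x\})=0$ for all $x\in\Omega$. Rearrangements: for measurable $f:\Omega\to\mathbb R$, $\mu_f(t)=\mu\{x:|f(x)|>t\}$, $f^*(t)=\inf\{\sigma\ge0:\mu_f(\sigma)\le t\}$, $f^{**}(t)=\frac1t\int_0^tf^*(\sigma)\,d\sigma$. For $0<\alpha\le1$, $O(|f|^\alpha,t)=(|f|^\alpha)^{**}(t)-(|f|^\alpha)^*(t)$. $\|f\|_{L^\alpha+L^\infty}$ is the usual sum quasi-norm $\inf\{\|f_0\|_{L^\alpha}+\|f_1\|_{L^\infty}:f=f_0+f_1\}$. A quasi-Banach rearrangement invariant space (q.r.i. space) $X$ on $\Omega$ is a subspace of $L^0(\Omega)$ (measurable functions with the topology of local convergence in measure) with a quasi-norm $\|\cdot\|_X$ such that: $X$ is complete; $X\hookrightarrow L^0$ is continuous; $\chi_E\in X$ whenever $\mu(E)<\infty$; if $0\le f_n\nearrow f$ a.e. and $f\in X$ then $\|f_n\|_X\nearrow\|f\|_X$; and $\|f\|_X=\|g\|_X$ whenever $f^*=g^*$. It is an r.i. space if $\|\cdot\|_X$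 is a norm. For $r>0$, $X^{(r)}=\{f:|f|^r\in X\}$ with $\|f\|_{X^{(r)}}=\||f|^r\|_X^{1/r}$. $X$ is $\alpha$-convex if there is $C>0$ with $\left\|\left(\sum_{j=1}^n|f_j|^\alpha\right)^{1/\alpha}\right\|_X\le C\left(\sum_{j=1}^n\|f_j\|_X^\alpha\right)^{1/\alpha}$ for all $f_1,\dots,f_n\in X$; then $\|\cdot\|_{X^{(1/\alpha)}}$ is equivalent to a norm, i.e. $X=Y^{(\alpha)}$ where $Y=X^{(1/\alpha)}$ is, up to equivalence, an r.i. space. The fundamental function is $\phi_X(t)=\|\chi_E\|_X$ for any measurable $E$ with $\mu(E)=t$. Besov seminorm (with the exponent $\alpha$ for which $X$ is $\alpha$-convex): for $f\in L^\alpha(\Omega)+L^\infty(\Omega)$ and $r>0$, $$\nabla_r^\alpha f(x)=\left(\frac1{\mu(B(x,r))}\int_{B(x,r)}|f(x)-f(y)|^\alpha d\mu(y)\right)^{1/\alpha},\qquad E_X(f,r)=\|\nabla_r^\alpha f\|_X,$$ and $\|f\|_{\dot B^s_{X,q}}=\left(\int_0^\infty\left(r^{-s}E_X(f,r)\right)^q\frac{dr}r\right)^{1/q}$ (supremum over $r>0$ if $q=\infty$); it may be $+\infty$.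
   Formalization: In (2) the constant C may depend on the given space Ω, μ and on X as well as on α and q (not on s or f); a C depending only on C_μ, α, q is impossible, as replacing Lebesgue measure by cμ with c→0 and X=L^1 shows. *)

(* Defs.v *)
From HB Require Import structures.
From mathcomp Require Import all_boot all_order all_algebra.
From mathcomp Require Import all_classical all_reals all_analysis.
From mathcomp Require Import measurable_realfun ess_sup_inf.

Set Implicit Arguments.
Unset Strict Implicit.
Unset Printing Implicit Defensive.

Import Order.TTheory GRing.Theory Num.Theory.
Import numFieldNormedType.Exports.

Local Open Scope classical_set_scope.
Local Open Scope ring_scope.
Local Open Scope ereal_scope.

#[short(type="metricMeasurableType")]
HB.structure Definition MetricMeasurable (d : measure_display) (R : realType) :=
  {T of Metric R T & Measurable d T}.

Section doubling.
Context (d : measure_display) (R : realType) (T : metricMeasurableType d R).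
Variable mu : {measure set T -> \bar R}.

Definition doubling_with (C : R) :=
  forall (x : T) (r : R), (0 < r)%R ->
    mu (ball x (2 * r)%R) <= C%:E * mu (ball x r).

Record doubling_space : Prop := DoublingSpace {
  measurable_borel : @measurable d T = <<s @open T >> ;
  ball_measure_gt0 : forall (x : T) (r : R), (0 < r)%R -> 0 < mu (ball x r) ;
  ball_measure_lty : forall (x : T) (r : R), (0 < r)%R -> mu (ball x r) < +oo ;
  ball_doubling : exists2 C : R, (1 < C)%R & doubling_with C
}.

(* The set below is bounded below, and when mu setT = +oo its infimum is
   attained and is > 1 (the constant 1 would force mu setT to be finite). *)
Definition doubling_constant : R :=
  inf [set C : R | (1 < C)%R /\ doubling_with C].

Definition upper_dimension : R := (ln doubling_constant / ln 2)%R.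

Definition non_collapsing :=
  exists2 b : R, (0 < b)%R & ereal_inf [set mu (ball x 1%R) | x in [set: T]] = b%:E.

End doubling.

Section rearrangement.
Context (d : measure_display) (R : realType) (T : measurableType d).
Variable mu : {measure set T -> \bar R}.
Implicit Types (f : T -> R) (t : R).

Definition distribution_fun f t : \bar R := mu [set x | (t < `|f x|)%R].

Definition rearrangement f t : \bar R :=
  ereal_inf [set sigma%:E | sigma in
    [set sigma : R | (0 <= sigma)%R /\ distribution_fun f sigma <= t%:E]].

Definition maximal_rearrangement f t : \bar R :=
  (t^-1)%:E * \int[lebesgue_measure]_(u in `]0%R, t[) rearrangement f u.

(* For f in L^alpha + L^oo and t > 0, with f replaced by |f|^alpha, both terms
   are finite and the difference is nonnegative. *)
Definition oscillation f t : \bar R :=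
  maximal_rearrangement f t - rearrangement f t.

Definition sum_decomposition f : set ((T -> R) * (T -> R)) :=
  [set h : (T -> R) * (T -> R) | [/\ measurable_fun [set: T] h.1, measurable_fun [set: T] h.2 &
               forall x, f x = (h.1 x + h.2 x)%R]].

Definition sum_norm (alpha : R) f : \bar R :=
  ereal_inf [set 'N[mu]_(alpha%:E)[EFin \o h.1] + 'N[mu]_(+oo)[EFin \o h.2]
            | h in sum_decomposition f].

Definition sum_space (alpha : R) : set (T -> R) :=
  [set f | exists2 h, sum_decomposition f h &
     finite_norm mu alpha%:E h.1 /\ finite_norm mu +oo h.2].

End rearrangement.

Section qri_space.
Context (d : measure_display) (R : realType) (T : measurableType d).
Variable mu : {measure set T -> \bar R}.

(* Elements of L^0 are represented by measurable functions; compatibility with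
   a.e. equality is a consequence of qri_invariant. The value of qri_norm is
   irrelevant outside qri_mem. *)
Record qri_space := QriSpace {
  qri_mem : set (T -> R) ;
  qri_norm : (T -> R) -> R ;
  qri_measurable : forall f, qri_mem f -> measurable_fun [set: T] f ;
  qri_mem0 : qri_mem (fun=> 0%R) ;
  qri_memD : forall f g, qri_mem f -> qri_mem g ->
    qri_mem (fun x => f x + g x)%R ;
  qri_memZ : forall (a : R) f, qri_mem f -> qri_mem (fun x => a * f x)%R ;
  qri_norm_ge0 : forall f, qri_mem f -> (0 <= qri_norm f)%R ;
  qri_norm_eq0 : forall f, qri_mem f ->
    (qri_norm f = 0%R <-> \forall x \ae mu, f x = 0%R) ;
  qri_normZ : forall (a : R) f, qri_mem f ->
    qri_norm (fun x => a * f x)%R = (`|a| * qri_norm f)%R ;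
  qri_quasi_triangle : exists K : R, forall f g, qri_mem f -> qri_mem g ->
    (qri_norm (fun x => f x + g x) <= K * (qri_norm f + qri_norm g))%R ;
  qri_complete : forall u : nat -> T -> R,
    (forall n, qri_mem (u n)) ->
    (forall e : R, (0 < e)%R -> exists N : nat, forall m n : nat,
       (N <= m)%N -> (N <= n)%N -> (qri_norm (fun x => u m x - u n x) < e)%R) ->
    exists2 f, qri_mem f &
      (fun n => qri_norm (fun x => u n x - f x)%R) @ \oo --> (0%R : R) ;
  (* continuity of the inclusion into L^0; the sets
     [set g | mu (A `&` [set x | e < |g x - f x|]) < eta], with A of finite
     measure, form a neighbourhood base at f for local convergence in measure *)
  qri_embedding : forall f, qri_mem f -> forall (A : set T) (e eta : R),
    measurable A -> mu A < +oo -> (0 < e)%R -> (0 < eta)%R ->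
    exists2 delta : R, (0 < delta)%R & forall g, qri_mem g ->
      (qri_norm (fun x => g x - f x) < delta)%R ->
      mu (A `&` [set x | (e < `|g x - f x|)%R]) < eta%:E ;
  qri_indic : forall E : set T, measurable E -> mu E < +oo ->
    qri_mem (\1_E : T -> R) ;
  qri_fatou : forall (u : nat -> T -> R) f,
    (forall n, measurable_fun [set: T] (u n)) ->
    (\forall x \ae mu, [/\ forall n, (0 <= u n x)%R,
       {homo (fun n => u n x) : m n / (m <= n)%N >-> (m <= n)%R} &
       u ^~ x @ \oo --> f x]) ->
    qri_mem f ->
    [/\ forall n, qri_mem (u n),
        {homo (fun n => qri_norm (u n)) : m n / (m <= n)%N >-> (m <= n)%R} &
        (fun n => qri_norm (u n)) @ \oo --> qri_norm f] ;
  qri_invariant : forall f g, qri_mem f -> measurable_fun [set: T] g ->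
    (forall t : R, (0 < t)%R -> rearrangement mu f t = rearrangement mu g t) ->
    qri_mem g /\ qri_norm f = qri_norm g
}.

Variable X : qri_space.

Definition qri_enorm (f : T -> R) : \bar R :=
  if f \in qri_mem X then (qri_norm X f)%:E else +oo.

Definition alpha_convex (alpha : R) :=
  exists2 C : R, (0 < C)%R & forall (n : nat) (f : 'I_n -> T -> R),
    (forall j, qri_mem X (f j)) ->
    qri_enorm (fun x => (\sum_(j < n) `|f j x| `^ alpha) `^ alpha^-1)%R <=
    (C * (\sum_(j < n) qri_norm X (f j) `^ alpha) `^ alpha^-1)%R%:E.

(* The choice of the set of measure t is immaterial, see fundamental_funE. *)
Definition fundamental_fun (t : R) : R :=
  qri_norm X (\1_(xget set0 [set E : set T | measurable E /\ mu E = t%:E])).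

Lemma rearrangement_indic_eq (E F : set T) (t : R) :
  mu E = mu F ->
  rearrangement mu (\1_E : T -> R) t = rearrangement mu (\1_F : T -> R) t.
Proof.
suff dE (G : set T) (s : R) : (0 <= s)%R ->
    distribution_fun mu (\1_G : T -> R) s = if (s < 1)%R then mu G else 0.
  move=> EF; congr (ereal_inf (_ @` _)).
  by apply/seteqP; split => s /= [s0]; rewrite !dE// EF.
move=> s0; rewrite /distribution_fun; case: ifPn => s1.
  congr (mu _); apply/seteqP; split => x /=; rewrite indicE.
    by case: (boolP (x \in G)) => [/set_mem//|_]; rewrite normr0 ltNge s0.
  by move=> Gx; rewrite mem_set// normr1.
rewrite (_ : [set x | _] = set0) ?measure0//; apply/seteqP; split => x //=.
rewrite indicE; case: (x \in G); rewrite ?normr1 ?normr0 => /= h.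
  by rewrite h in s1.
by move: h; rewrite ltNge s0.
Qed.

Lemma fundamental_funE (E : set T) (t : R) :
  measurable E -> mu E = t%:E -> fundamental_fun t = qri_norm X \1_E.
Proof.
move=> mE Et; rewrite /fundamental_fun.
case: xgetP => [F _ [mF Ft]|/(_ E)]; last by case.
have F_lty : mu F < +oo by rewrite Ft ltry.
apply: (qri_invariant (qri_indic X mF F_lty) _ _).2 => [|s _].
  exact: measurable_indic.
by apply: rearrangement_indic_eq; rewrite Ft Et.
Qed.

End qri_space.

(* The L^q norm of g on D for the measure dt / t. *)
Definition Lq_dt_over_t (R : realType) (q : \bar R) (D : set R)
    (g : R -> \bar R) : \bar R :=
  match q with
  | q'%:E => (\int[lebesgue_measure]_(t in D) (g t `^ q' * (t^-1)%:E)) `^ q'^-1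
  | _ => ereal_sup [set g t | t in D]
  end.

Section besov.
Context (d : measure_display) (R : realType) (T : metricMeasurableType d R).
Variables (mu : {measure set T -> \bar R}) (alpha : R).

(* For f in L^alpha + L^oo the integral is finite for every x. *)
Definition gradient (r : R) (f : T -> R) (x : T) : R :=
  (((fine (mu (ball x r)))^-1 *
    \int[mu]_(y in ball x r) (`|f x - f y| `^ alpha)) `^ alpha^-1)%R.

Variable X : qri_space mu.

Definition besov_modulus (f : T -> R) (r : R) : \bar R :=
  qri_enorm X (gradient r f).

Definition besov_seminorm (s : R) (q : \bar R) (f : T -> R) : \bar R :=
  Lq_dt_over_t q `]0%R, +oo[ (fun r => (r `^ (- s))%:E * besov_modulus f r).

End besov.

(* Main.v *)
Require Import Defs.
From HB Require Import structures.
From mathcomp Require Import all_boot all_order all_algebra.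
From mathcomp Require Import all_classical all_reals all_analysis.
From mathcomp Require Import measurable_realfun ess_sup_inf.
From mathcomp Require Import lra ring.

(** From non-collapsing to the estimate. The space is separable without atoms,
    hence carries a measurable function Psi whose sublevel sets [Psi <= u] have
    measure u: a sequence of balls separating the points embeds the space
    measurably in the reals, with null level sets, and the embedding is composed
    with its own distribution function (exists_uniform_map). Every decreasing
    function of Psi is thus its own rearrangement, and a rearrangement-invariant
    quasi-norm may be computed on such functions. Alpha-convexity applied to the
    n+1 cyclic shifts of a step function of Psi, whose alpha-th powers add up to a
    constant, gives a substitute for averaging (cyclic_average), which yields two
    facts: phi(t)^alpha / t is almost decreasing, phi being the fundamental function
    (fundamental_fun_quasiconcave), and, for g = |f|^alpha, the quantity
    O(g,t)^(1/alpha) phi(t) is at most a constant times the quasi-norm of any G with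
    g - g^*(t) <= 2 G^alpha (oscillation_average). If every ball of radius r has
    measure at least 2 t, then at least half of B(x,r) consists of points where
    g <= g^*(t), whence the gradient of f at radius r is such a G
    (excess_le_gradient). Non-collapsing and doubling provide this for t of order
    D^-k and r of order 2^-k, where D is the doubling constant; as D = 2^Q,
    t^(-s/Q) and r^-s are comparable there, and the contributions of all k add up
    to the Besov seminorm (Lq_dyadic_comparison). The values of t bounded away
    from 0 are handled by the norm of L^alpha + L^oo, which controls the mean of g^*
    (oscillation_le_sum_norm).

    From the estimate to non-collapsing. Only q = oo and one value of s are used,
    and f is the cone (1 - d(x0,y))_+, with m = mu(B(x0,1)) < 1. The oscillation at
    t = m is bounded below by a constant, so the left-hand side is at least a
    constant times phi(m) m^(-s/Q) (oscillation_cone_ge). On the right, the gradient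
    at radius r <= 1 is at most r on B(x0,2) and 0 elsewhere; at radius r > 1 its
    alpha-th power is at most the indicator of B(x0,1) plus a mass of order m
    spread evenly over B(x0,2r). Since phi(t)^alpha / t is almost decreasing, the
    seminorm is at most a constant times phi(m) (besov_seminorm_cone_le), and so is
    the norm of f in L^alpha + L^oo, at most m^(1/alpha). Hence m^(-s/Q) is bounded
    independently of x0 (estimate_noncollapsing). *)

Set Implicit Arguments.
Unset Strict Implicit.
Unset Printing Implicit Defensive.

Import Order.TTheory GRing.Theory Num.Theory.
Import numFieldNormedType.Exports.

Local Open Scope classical_set_scope.
Local Open Scope ring_scope.
Local Open Scope ereal_scope.

(** * Monotone limits of measures *)

Section measure_limits.
Context (d : measure_display) (R : realType) (T : measurableType d).
Variable mu : {measure set T -> \bar R}.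
Implicit Types F : nat -> set T.

Lemma le_mu (A B : set T) : measurable A -> measurable B -> A `<=` B ->
  mu A <= mu B.
Proof. by move=> mA mB AB; apply: le_measure; rewrite ?inE. Qed.

Lemma bigcup_measure_le F (a : \bar R) : (forall n, measurable (F n)) ->
  {homo F : n m / (n <= m)%N >-> n `<=` m} ->
  (forall n, mu (F n) <= a) -> mu (\bigcup_n F n) <= a.
Proof.
move=> mF ndF Fa.
have cv : (mu \o F) @ \oo --> mu (\bigcup_n F n).
  apply: nondecreasing_cvg_mu => // [|n m nm]; first exact: bigcup_measurable.
  exact/subsetPset/ndF.
rewrite -(cvg_lim _ cv)//; apply: lime_le; first exact/cvg_ex/ex_intro/cv.
by apply: nearW => n; exact: Fa.
Qed.

Lemma bigcap_measure_ge F (a : \bar R) : (forall n, measurable (F n)) ->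
  {homo F : n m / (n <= m)%N >-> m `<=` n} -> mu (F 0%N) < +oo ->
  (forall n, a <= mu (F n)) -> a <= mu (\bigcap_n F n).
Proof.
move=> mF niF F0 Fa.
have cv : (mu \o F) @ \oo --> mu (\bigcap_n F n).
  apply: nonincreasing_cvg_mu => // [|n m nm]; first exact: bigcap_measurable.
  exact/subsetPset/niF.
rewrite -(cvg_lim _ cv)//; apply: lime_ge; first exact/cvg_ex/ex_intro/cv.
by apply: nearW => n; exact: Fa.
Qed.

End measure_limits.

Section measurable_comparison.
Context (d : measure_display) (R : realType) (T : measurableType d).
Variables f g : T -> R.
Hypotheses (mf : measurable_fun [set: T] f) (mg : measurable_fun [set: T] g).

Lemma measurable_set_ler : measurable [set x | (f x <= g x)%R].
Proof. by rewrite -[X in measurable X]setTI; exact: measurable_fun_le. Qed.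

Lemma measurable_set_ltr : measurable [set x | (g x < f x)%R].
Proof.
rewrite (_ : [set _ | _] = ~` [set x | (f x <= g x)%R]).
  exact/measurableC/measurable_set_ler.
by apply/seteqP; split => x /=; rewrite ltNge => /negP.
Qed.

End measurable_comparison.

(** * Balls in a doubling space *)

Section metric_ball.
Context (d : measure_display) (R : realType) (T : metricMeasurableType d R).

Lemma in_ball (x y : T) (r : R) : ball x r y = (mdist x y < r)%R :> Prop.
Proof. by rewrite ballEmdist. Qed.

Lemma open_metric_ball (x : T) (r : R) : open (ball x r).
Proof.
rewrite openE => y; rewrite in_ball => xy.
apply/nbhs_ballP; exists (r - mdist x y)%R; first by rewrite /= subr_gt0.
move=> z; rewrite !in_ball => yz.
by apply: le_lt_trans (metric_triangle _ y _) _; rewrite -ltrBrDl.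
Qed.

Lemma ball_subset (x y : T) (r r' : R) :
  (mdist y x + r <= r')%R -> ball x r `<=` ball y r'.
Proof.
move=> h z; rewrite !in_ball => xz; apply: lt_le_trans h.
by apply: le_lt_trans (metric_triangle _ x _) _; rewrite ltrD2l.
Qed.

End metric_ball.

Section doubling_geometry.
Context (d : measure_display) (R : realType) (T : metricMeasurableType d R).
Variable mu : {measure set T -> \bar R}.
Hypothesis mu_doubling : doubling_space mu.
Hypothesis mu_infinite : mu [set: T] = +oo.

Let D := doubling_constant mu.

Lemma measurable_metric_ball (x : T) (r : R) : measurable (ball x r).
Proof.
rewrite (measurable_borel mu_doubling); apply: sub_sigma_algebra.
exact: open_metric_ball.
Qed.

Lemma ball_measure_fin (x : T) (r : R) : mu (ball x r) \is a fin_num.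
Proof.
rewrite ge0_fin_numE//; have [r0|r0] := ltP 0%R r.
  exact: ball_measure_lty.
rewrite (_ : ball x r = set0) ?measure0 ?ltry// -subset0 => y.
by rewrite in_ball => /lt_le_trans/(_ r0); rewrite ltNge mdist_ge0.
Qed.

Lemma doubling_with_iter (C : R) (x : T) (r : R) (n : nat) :
  (0 <= C)%R -> doubling_with mu C -> (0 < r)%R ->
  mu (ball x (2 ^+ n * r)%R) <= (C ^+ n)%:E * mu (ball x r).
Proof.
move=> C0 dC r0; elim: n => [|n IH]; first by rewrite !expr0 mul1r mul1e.
rewrite exprS -mulrA; apply: le_trans (dC _ _ _) _.
  by rewrite mulr_gt0// exprn_gt0.
by rewrite exprS EFinM -muleA; apply: lee_pmul => //; rewrite lee_fin.
Qed.

Lemma doubling_constantP : (1 < D)%R /\ doubling_with mu D.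
Proof.
have [C C1 dC] := ball_doubling mu_doubling.
have D1 : (1 <= D)%R.
  by apply: lb_le_inf; [exists C | move=> z [/ltW]].
have dD : doubling_with mu D.
  move=> x r r0.
  have m0 : (0 < fine (mu (ball x r)))%R.
    by rewrite fine_gt0// (ball_measure_gt0 mu_doubling)//= (ball_measure_lty mu_doubling).
  have h C' : (mu (ball x (2 * r)%R) <= C'%:E * mu (ball x r)) =
      (fine (mu (ball x (2 * r)%R)) / fine (mu (ball x r)) <= C')%R.
    by rewrite ler_pdivrMr// -lee_fin EFinM !fineK ?ball_measure_fin.
  rewrite h; apply: lb_le_inf; first by exists C.
  by move=> z [_ dz]; rewrite -h; exact: dz.
split=> //; rewrite lt_neqAle D1 andbT; apply/eqP => D1'.
(* A doubling constant equal to 1 would bound the measure of all balls around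
   a point by the measure of one of them. *)
have := mu_infinite.
have -> : [set: T] = \bigcup_n ball (point : T) (2 ^+ n * 1)%R.
  apply/seteqP; split => // y _.
  exists (Num.trunc (mdist point y)).+1 => //; rewrite in_ball mulr1.
  apply: lt_le_trans (truncnS_gt _) _.
  by rewrite -natrX ler_nat ltnW// ltn_expl.
have ub n : mu (ball (point : T) (2 ^+ n * 1)%R) <= mu (ball (point : T) 1%R).
  have /= := doubling_with_iter point n ler01 _ (@ltr01 R).
  by rewrite expr1n mul1e; apply; rewrite D1'.
move=> oo; have : mu (\bigcup_n ball (point : T) (2 ^+ n * 1)%R) <=
    mu (ball (point : T) 1%R).
  apply: bigcup_measure_le => // [n|n m nm]; first exact: measurable_metric_ball.
  by apply: ball_subset; rewrite mdistxx add0r !mulr1 ler_weXn2l// ler1n.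
by rewrite oo leye_eq => /eqP h; have := ball_measure_lty mu_doubling point (@ltr01 R); rewrite h.
Qed.

Lemma ball_doubling_iter (x : T) (r : R) (n : nat) : (0 < r)%R ->
  mu (ball x (2 ^+ n * r)%R) <= (D ^+ n)%:E * mu (ball x r).
Proof.
have [D1 dD] := doubling_constantP.
by apply: doubling_with_iter => //; exact/ltW/(lt_trans ltr01).
Qed.

Lemma upper_dimension_gt0 : (0 < upper_dimension mu)%R.
Proof.
have [D1 _] := doubling_constantP.
by rewrite divr_gt0// ln_gt0// ltr1n.
Qed.

Lemma powR2_upper_dimension : (2 `^ upper_dimension mu = D)%R.
Proof.
have [D1 _] := doubling_constantP.
rewrite /powR pnatr_eq0/= /upper_dimension divfK ?lnK//.
  by rewrite posrE (lt_trans ltr01).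
by rewrite gt_eqF// ln_gt0// ltr1n.
Qed.

End doubling_geometry.

(** * Separability of doubling spaces *)

Section separability.
Context (d : measure_display) (R : realType) (T : metricMeasurableType d R).
Variable mu : {measure set T -> \bar R}.
Hypothesis mu_doubling : doubling_space mu.
Hypothesis mu_infinite : mu [set: T] = +oo.

Let separated (e : R) : rel T := fun a b => (e <= mdist a b)%R.

(** Balls of half the separation are disjoint, so their measures add up. *)
Lemma separated_measure (e m : R) (s : seq T) : (0 < e)%R ->
  (forall x, x \in s -> m%:E <= mu (ball x (e / 2)%R)) ->
  pairwise (separated e) s ->
  (m *+ size s)%:E <= mu (\big[setU/set0]_(y <- s) ball y (e / 2)%R).
Proof.
move=> e0; elim: s => [|a s IH] ms; first by rewrite big_nil measure0.
rewrite pairwise_cons => /andP[/allP as_ ps]; rewrite big_cons measureU.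
- rewrite /= mulrS EFinD leeD// ?ms ?mem_head// IH// => x xs.
  by rewrite ms// in_cons xs orbT.
- exact: (measurable_metric_ball mu_doubling).
- by apply: bigsetU_measurable => x _; exact: (measurable_metric_ball mu_doubling).
apply/seteqP; split => // z []; rewrite in_ball => az.
rewrite -bigcup_seq => -[y/= ys]; rewrite in_ball => yz.
have := as_ _ ys; rewrite /separated leNgt => /negP; apply.
apply: le_lt_trans (metric_triangle _ z _) _.
by rewrite (splitr e) ltrD// metric_sym.
Qed.

(** Disjoint balls of radius e/2 centred in a ball of radius N have measures
    bounded below, by doubling, so a maximal e-separated family is finite. *)
Lemma finite_net (o : T) (N e : R) : (0 < N)%R -> (0 < e)%R ->
  exists s : seq T, forall x, ball o N x -> exists2 y, y \in s & ball y e x.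
Proof.
move=> N0 e0.
have [D1 _] := doubling_constantP mu_doubling mu_infinite.
set D := doubling_constant mu in D1; have D0 : (0 < D)%R := lt_trans ltr01 D1.
pose p := (Num.trunc (2 * N / (e / 2))).+1.
have e20 : (0 < e / 2)%R by rewrite divr_gt0.
have pN : (2 * N <= 2 ^+ p * (e / 2))%R.
  rewrite -ler_pdivrMr//; apply/ltW/(lt_le_trans (truncnS_gt _)).
  by rewrite -natrX ler_nat ltnW// ltn_expl.
pose M := fine (mu (ball o N)); pose M' := fine (mu (ball o (N + e)%R)).
have M0 : (0 < M)%R.
  by rewrite fine_gt0// (ball_measure_gt0 mu_doubling)//= (ball_measure_lty mu_doubling).
have lb x : ball o N x -> (M / D ^+ p)%:E <= mu (ball x (e / 2)%R).
  rewrite in_ball => ox; rewrite -[leRHS]fineK ?ball_measure_fin// lee_fin.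
  rewrite ler_pdivrMr ?exprn_gt0// mulrC -lee_fin EFinM !fineK ?ball_measure_fin//.
  apply: le_trans (ball_doubling_iter mu_doubling mu_infinite _ _ e20).
  apply: le_mu; [exact: (measurable_metric_ball mu_doubling)..|].
  apply: ball_subset; apply: le_trans pN.
  by rewrite mulr_natl mulr2n lerD2r metric_sym ltW.
pose P n := `[< exists s : seq T, [/\ size s = n,
  {in s, forall x, ball o N x} & pairwise (separated e) s] >].
have P0 : exists n, P n by exists 0%N; apply/asboolP; exists [::].
have Pub n : P n -> (n <= Num.trunc (M' / (M / D ^+ p)))%N.
  move=> /asboolP[s [<- so ss]].
  rewrite truncn_ge_nat; last by rewrite !divr_ge0// ?fine_ge0// exprn_ge0// ltW.
  rewrite ler_pdivlMr ?divr_gt0 ?exprn_gt0// -lee_fin.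
  rewrite [X in _ <= X]fineK ?ball_measure_fin// mulr_natl.
  have := separated_measure e0 (fun x xs => lb x (so x xs)) ss.
  move/le_trans; apply; apply: le_mu.
  - by apply: bigsetU_measurable => x _; exact: (measurable_metric_ball mu_doubling).
  - exact: (measurable_metric_ball mu_doubling).
  rewrite -bigcup_seq => z [y /= ys]; apply: ball_subset.
  have := so _ ys; rewrite in_ball => oy.
  by move: oy e0; clear; lra.
case: (ex_maxnP P0 Pub) => n /asboolP[s [sn so ss]] maxn.
exists s => x ox; apply: contrapT => nx.
have : P n.+1.
  apply/asboolP; exists (x :: s); split; first by rewrite /= sn.
    by move=> y; rewrite in_cons => /predU1P[->//|/so].
  rewrite pairwise_cons ss andbT; apply/allP => y ys.
  rewrite /separated leNgt; apply/negP => xy; apply: nx; exists y => //.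
  by rewrite in_ball metric_sym.
by move=> /maxn; rewrite ltnn.
Qed.

Lemma exists_dense_sequence :
  exists z : nat -> T, forall x (e : R), (0 < e)%R -> exists n, ball (z n) e x.
Proof.
have h (p : nat * nat) : exists s : seq T, forall x,
    ball (point : T) p.1.+1%:R x -> exists2 y, y \in s & ball y p.2.+1%:R^-1%R x.
  by apply: finite_net; rewrite ?invr_gt0 ltr0n.
have [S hS] := choice h.
pose z n := if @unpickle (nat * nat * nat)%type n is Some (p, i)
  then nth (point : T) (S p) i else point.
exists z => x e e0.
have xN : ball (point : T) (Num.trunc (mdist (point : T) x)).+1%:R x.
  by rewrite in_ball truncnS_gt.
have [y yS yx] := hS (Num.trunc (mdist (point : T) x), Num.trunc e^-1%R) x xN.
exists (pickle (Num.trunc (mdist (point : T) x), Num.trunc e^-1%R, index y (S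
  (Num.trunc (mdist (point : T) x), Num.trunc e^-1%R)))).
rewrite /z pickleK nth_index//; apply: ball_subset yx.
by rewrite mdistxx add0r invf_ple ?posrE ?ltr0n//= ltW// truncnS_gt.
Qed.

End separability.

(** * Encoding points by real numbers *)

Section injective_encoding.
Context (d : measure_display) (R : realType) (T : measurableType d).
Variable U : nat -> set T.
Hypothesis mU : forall n, measurable (U n).

Let S n x : R := (\sum_(i < n) 3^-1 ^+ i * \1_(U i) x)%R.

Let SS n x : (S n.+1 x = S n x + 3^-1 ^+ n * \1_(U n) x)%R.
Proof. by rewrite /S big_ord_recr. Qed.

Let S_incr x : {homo S ^~ x : m n / (m <= n)%N >-> (m <= n)%R}.
Proof.
apply: homo_leq => [//|y z t|n]; first exact: le_trans.
by rewrite SS lerDl mulr_ge0// ?exprn_ge0// indicE.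
Qed.

(* The terms of index at least n add up to at most 3/2 * 3^-n. *)
Let S_decr x :
  {homo (fun n => S n x + 3 / 2 * 3^-1 ^+ n)%R : m n / (m <= n)%N >-> (n <= m)%R}.
Proof.
apply: (@homo_leq _ _ (fun a b => b <= a)%R) => [//|y z t zy tz|n]; first exact: le_trans tz zy.
rewrite SS exprS.
have : (0 <= (\1_(U n) x : R) <= 1)%R by rewrite indicE; case: (_ \in _); rewrite lexx ler01.
have : (0 <= 3^-1 ^+ n :> R)%R by rewrite exprn_ge0.
move: (\1_(U n) x) (3^-1 ^+ n)%R (S n x) => a b c b0 /andP[a0 a1].
suff : (b * a <= b)%R by lra.
by rewrite ler_piMr.
Qed.

Let Phi x : R := limn (S ^~ x).

Let S_cvg x : S ^~ x @ \oo --> Phi x.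
Proof.
apply: nondecreasing_is_cvgn; first exact: S_incr.
exists (3 / 2)%R => _ [n _ <-].
have := @S_decr x 0%N n (leq0n n); rewrite /S big_ord0 add0r expr0 mulr1.
by apply: le_trans; rewrite lerDl mulr_ge0// exprn_ge0.
Qed.

Let Phi_ge n x : (S n x <= Phi x)%R.
Proof.
apply: limr_ge; first exact/cvg_ex/ex_intro/S_cvg.
by near=> m; apply: S_incr; near: m; exists n.
Unshelve. all: by end_near. Qed.

Let Phi_le n x : (Phi x <= S n x + 3 / 2 * 3^-1 ^+ n)%R.
Proof.
apply: limr_le; first exact/cvg_ex/ex_intro/S_cvg.
near=> m; apply: le_trans (@S_decr x n m _); last by near: m; exists n.
by rewrite lerDl mulr_ge0// exprn_ge0.
Unshelve. all: by end_near. Qed.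

Let Phi_measurable : measurable_fun [set: T] Phi.
Proof.
apply: (@measurable_fun_cvg _ _ _ _ (fun n x => S n x)) => [n|x _].
  apply: measurable_sum => i; apply: measurable_funM; first exact: measurable_cst.
  exact: measurable_indic.
exact: S_cvg.
Qed.

(* At the first index n where x and y are told apart, the digit contributes
   3^-n, more than the 3^-n / 2 that all later digits can make up for. *)
Let Phi_digit x y n : (forall i, (i < n)%N -> (x \in U i) = (y \in U i)) ->
  x \in U n -> y \notin U n -> (Phi y < Phi x)%R.
Proof.
move=> xy xn yn; apply: le_lt_trans (Phi_le n.+1 y) _.
apply: lt_le_trans (Phi_ge n.+1 x); rewrite !SS !indicE xn (negbTE yn).
have -> : S n y = S n x.
  by rewrite /S; apply: eq_bigr => i _; rewrite !indicE xy.
rewrite exprS; have : (0 < 3^-1 ^+ n :> R)%R by rewrite exprn_gt0.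
by move: (3^-1 ^+ n)%R => a /=; lra.
Qed.

(** Base 3 expansions with digits in {0, 1} are unique, so x can be recovered
    from the real number whose n-th digit tells whether x is in U n. *)
Lemma exists_injective_measurable :
  (forall x y, (forall n, x \in U n = (y \in U n)) -> x = y) ->
  exists Phi : T -> R, [/\ measurable_fun [set: T] Phi, injective Phi &
    forall x, (0 <= Phi x <= 3 / 2)%R].
Proof.
move=> sepU; exists Phi; split=> // [x y xy|x]; last first.
  have := Phi_ge 0%N x; have := Phi_le 0%N x.
  by rewrite /S big_ord0 add0r expr0 mulr1 => -> ->.
apply: sepU; apply: contrapT => /existsNP[n /eqP xyn].
have h : exists n, (x \in U n) != (y \in U n) by exists n.
case: (ex_minnP h) => m xym mmin.
have lt_m i : (i < m)%N -> (x \in U i) = (y \in U i).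
  by move=> im; apply/eqP; apply/negP => /negP /mmin; rewrite leqNgt im.
move: xym; case: (boolP (x \in U m)) => xm; case: (boolP (y \in U m)) => ym // _.
  by have := Phi_digit lt_m xm ym; rewrite xy ltxx.
by have := Phi_digit (fun i im => esym (lt_m i im)) ym xm; rewrite xy ltxx.
Qed.

End injective_encoding.

(** * A coordinate with uniform distribution *)

Section measure_preserving.
Context (d : measure_display) (R : realType) (T : measurableType d).
Variable mu : {measure set T -> \bar R}.
Hypothesis mu_infinite : mu [set: T] = +oo.
Variable G : T -> R.
Hypothesis mG : measurable_fun [set: T] G.
Hypothesis G_ge0 : forall x, (0 <= G x)%R.
Hypothesis G_fin : forall c, mu [set x | (G x <= c)%R] < +oo.
Hypothesis G_null : forall c, mu [set x | G x = c] = 0.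

Let sub c := [set x | (G x <= c)%R].

Let msub c : measurable (sub c).
Proof. by rewrite -[sub c]setTI; apply: measurable_fun_le. Qed.

Let F c := fine (mu (sub c)).

Let FE c : mu (sub c) = (F c)%:E.
Proof. by rewrite fineK// ge0_fin_numE//; exact: G_fin. Qed.

Let F_nd : {homo F : a b / (a <= b)%R}.
Proof.
move=> a b ab; rewrite -lee_fin -!FE; apply: le_measure; rewrite ?inE//.
by move=> x /le_trans; apply.
Qed.

Let F_unbounded (u : R) : exists c, (u < F c)%R.
Proof.
apply: contrapT => /forallNP Fu.
suff : mu (\bigcup_n sub n%:R) <= u%:E.
  rewrite (_ : \bigcup_n _ = setT) ?mu_infinite ?leye_eq//.
  apply/seteqP; split => // x _; exists (Num.trunc (G x)).+1 => //.
  exact/ltW/truncnS_gt.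
apply: bigcup_measure_le => // [n m nm x /le_trans|n]; last first.
  by rewrite FE lee_fin leNgt; exact/negP/Fu.
by apply; rewrite ler_nat.
Qed.

(** The distribution function F of G is continuous: from the right because
    sublevel sets have finite measure, from the left because level sets are
    null. The largest c with F c = u is the one for which F (G x) <= u is the
    same as G x <= c. *)
Let F_attains (u : R) : (0 <= u)%R ->
  exists c, F c = u /\ forall c', (c < c')%R -> (u < F c')%R.
Proof.
move=> u0; pose A := [set c | (F c <= u)%R].
have A0 : A (-1)%R.
  rewrite /A /= /F (_ : sub _ = set0) ?measure0//.
  apply/seteqP; split => // x; rewrite /sub/= => /(le_trans (G_ge0 x)).
  by rewrite ler0N1.
have Aub : has_ubound A.
  have [c uc] := F_unbounded u; exists c => c' /= c'u.
  rewrite leNgt; apply/negP => /ltW/F_nd; rewrite leNgt => /negP; apply.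
  exact: le_lt_trans uc.
pose c := sup A.
have gtc c' : (c < c')%R -> (u < F c')%R.
  move=> cc'; rewrite ltNge; apply/negP => h.
  by have := ub_le_sup Aub h; rewrite leNgt cc'.
exists c; split => //; apply/eqP; rewrite eq_le; apply/andP; split.
- rewrite -lee_fin -FE.
  have -> : sub c = (\bigcup_n sub (c - n.+1%:R^-1)%R) `|` [set x | G x = c].
    apply/seteqP; split => [x|x [[n _]|]].
    + rewrite /sub /= le_eqVlt => /orP[/eqP->|xc]; first by right.
      left; exists (Num.trunc (c - G x)^-1) => //=.
      rewrite lerBrDr -lerBrDl invf_ple ?posrE ?subr_gt0//.
      exact/ltW/truncnS_gt.
    + by move=> /le_trans; apply; rewrite gerBl invr_ge0.
    + by rewrite /sub /= => ->.
  have mnull : measurable [set x | G x = c].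
    by rewrite -[X in measurable X]setTI; exact: (mG measurableT (measurable_set1 c)).
  apply: le_trans (measureU2 _ _ _) _ => //; first exact: bigcup_measurable.
  rewrite [X in _ + X](_ : _ = 0) ?adde0; last exact: G_null.
  apply: bigcup_measure_le => // [n m nm x /le_trans|n].
    by apply; rewrite lerB// lef_pV2 ?posrE ?ltr0n// ler_nat.
  rewrite FE lee_fin.
  have : (c - n.+1%:R^-1 < c)%R by rewrite gtrBl invr_gt0.
  by move=> /(sup_gt (ex_intro A _ A0))[c' Ac' /ltW/F_nd/le_trans]; exact.
- rewrite -lee_fin -FE.
  have -> : sub c = \bigcap_n sub (c + n.+1%:R^-1)%R.
    apply/seteqP; split => [x xc n _|x xc] /=.
      by apply: le_trans xc _; rewrite lerDl invr_ge0.
    rewrite /sub /= leNgt; apply/negP => cx.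
    have := xc (Num.trunc (G x - c)^-1) I; rewrite /sub /= -lerBlDl leNgt => /negP; apply.
    by rewrite invf_plt ?posrE ?subr_gt0// truncnS_gt.
  apply: bigcap_measure_ge => // [n m nm x /le_trans||n]; last 2 first.
  + exact: G_fin.
  + by rewrite FE lee_fin; apply/ltW/gtc; rewrite ltrDl invr_gt0.
  by apply; rewrite lerD2l lef_pV2 ?posrE ?ltr0n// ler_nat.
Qed.

(** Composing G with its own cumulative distribution function makes the
    distribution uniform, since that function is continuous. *)
Lemma uniformization : exists2 Psi : T -> R, measurable_fun [set: T] Psi &
  forall u : R, (0 <= u)%R -> mu [set x | (Psi x <= u)%R] = u%:E.
Proof.
exists (F \o G) => [|u u0].
  by apply: measurableT_comp => //; exact: nondecreasing_measurable.
have [c [<- gtc]] := F_attains u0; rewrite -FE; congr (mu _).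
apply/seteqP; split => x; rewrite /sub/=; last exact: F_nd.
by apply: contra_le; exact: gtc.
Qed.

End measure_preserving.

Section uniform_map.
Context (d : measure_display) (R : realType) (T : metricMeasurableType d R).
Variable mu : {measure set T -> \bar R}.
Hypothesis mu_doubling : doubling_space mu.
Hypothesis mu_infinite : mu [set: T] = +oo.
Hypothesis mu_point : forall x : T, mu [set x] = 0.

Lemma measurable_mdist (o : T) : measurable_fun [set: T] (mdist o : T -> R).
Proof.
apply: (measurability _ (RGenInftyO.measurableE R)) => //.
move=> _ [_ [a ->] <-]; rewrite setTI.
rewrite (_ : _ @^-1` _ = ball o a); first exact: (measurable_metric_ball mu_doubling).
by apply/seteqP; split => x; rewrite in_ball /= in_itv.
Qed.

(** A sequence of balls separating the points encodes each point as a real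
    number. Adding twice the integer part of the distance to a base point makes
    sublevel sets bounded, hence of finite measure, and level sets are at most
    singletons, hence null. *)
Lemma exists_uniform_map : exists2 Psi : T -> R, measurable_fun [set: T] Psi &
  forall u : R, (0 <= u)%R -> mu [set x | (Psi x <= u)%R] = u%:E.
Proof.
have [z hz] := exists_dense_sequence mu_doubling mu_infinite.
pose U n : set T := if @unpickle (nat * nat)%type n is Some (i, j)
  then ball (z i) (j.+1%:R^-1 : R) else set0.
have mU n : measurable (U n).
  rewrite /U; case: (unpickle n) => [[i j]|//].
  exact: (measurable_metric_ball mu_doubling).
have sepU (x y : T) : (forall n, x \in U n = (y \in U n)) -> x = y.
  move=> xyU; apply: contrapT => /eqP; rewrite -mdist_gt0 => xy.
  pose j := Num.trunc (2 / mdist x y).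
  have [i zx] : exists i, ball (z i) (j.+1%:R^-1 : R) x.
    by apply: hz; rewrite invr_gt0 ltr0n.
  have := xyU (pickle (i, j)); rewrite /U pickleK (mem_set zx) => /esym/set_mem.
  move: zx; rewrite !in_ball => zx zy.
  have := metric_triangle x (z i) y.
  rewrite leNgt => /negP; apply; rewrite metric_sym.
  apply: lt_le_trans (ltrD zx zy) _.
  have half (a b : R) : (a <= b / 2 -> a + a <= b)%R by lra.
  apply: half; rewrite invf_ple ?posrE ?ltr0n ?divr_gt0//.
  by rewrite invf_div; exact/ltW/truncnS_gt.
have [Phi [mPhi injPhi Phib]] := exists_injective_measurable R mU sepU.
pose N x : R := (Num.trunc (mdist (point : T) x))%:R.
have mN : measurable_fun [set: T] N.
  have mtrunc : measurable_fun [set: R] (fun y : R => (Num.trunc y)%:R : R).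
    by apply: nondecreasing_measurable => // a b ab; rewrite ler_nat le_truncn.
  exact: measurableT_comp mtrunc (measurable_mdist _).
apply: (@uniformization _ _ _ mu mu_infinite (fun x => 2 * N x + Phi x)%R).
- by apply: measurable_funD => //; apply: measurable_funM.
- by move=> x; have /andP[p0 _] := Phib x; rewrite addr_ge0// mulr_ge0// ler0n.
- move=> c; apply: (@le_lt_trans _ _ (mu (ball (point : T) (`|c| + 1)%R))).
    apply: le_mu.
    + rewrite -[X in measurable X]setTI; apply: measurable_fun_le => //.
      by apply: measurable_funD => //; apply: measurable_funM.
    + exact: (measurable_metric_ball mu_doubling).
    + move=> x /= xc; rewrite in_ball.
      apply: lt_le_trans (truncnS_gt _) _; rewrite -natr1 lerD2r -/(N x).
      have /andP[p0 _] := Phib x; have N0 : (0 <= N x)%R by rewrite ler0n.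
      by have := ler_norm c; move: xc p0 N0; clear; lra.
  by apply: (ball_measure_lty mu_doubling); rewrite ltr_wpDl.
- move=> c; have [[x xc]|/set0P/negP/negPn/eqP E] :=
    pselect ([set x | (2 * N x + Phi x)%R = c] !=set0); last by rewrite E measure0.
  rewrite (_ : [set _ | _] = [set x]) ?mu_point//; apply/seteqP; split => [y /= yc|y /= ->//].
  apply: injPhi; suff E : N x = N y by move: xc yc; rewrite /= E => <- /addrI.
  have gap (a b p q : R) : (p <= 3 / 2 -> 0 <= q -> 2 * a + p = 2 * b + q ->
      ~ (a + 1 <= b))%R by lra.
  have lt1 u v : (2 * N u + Phi u = c)%R -> (2 * N v + Phi v = c)%R ->
      ~ (Num.trunc (mdist (point : T) u) < Num.trunc (mdist (point : T) v))%N.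
    move=> cu cv; rewrite -(ler_nat R) -[X in (X <= _)%R]natr1 -/(N u) -/(N v).
    have /andP[_ u1] := Phib u; have /andP[v0 _] := Phib v.
    by apply: gap u1 v0 _; rewrite cu cv.
  rewrite /N; suff -> : Num.trunc (mdist (point : T) x) =
      Num.trunc (mdist (point : T) y) by [].
  apply/eqP; rewrite eqn_leq; apply/andP.
  by split; rewrite leqNgt; apply/negP; apply: lt1.
Qed.
End uniform_map.

(** * Rearrangements *)

Section rearrangement_theory.
Context (d : measure_display) (R : realType) (T : measurableType d).
Variable mu : {measure set T -> \bar R}.
Variable f : T -> R.
Hypothesis mf : measurable_fun [set: T] f.

Lemma measurable_superlevel (s : R) : measurable [set x | (s < `|f x|)%R].
Proof.
by apply: measurable_set_ltr => //; exact: measurableT_comp.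
Qed.

Lemma distribution_fun_noninc (s s' : R) : (s <= s')%R ->
  distribution_fun mu f s' <= distribution_fun mu f s.
Proof.
move=> ss'; apply: le_mu; [exact: measurable_superlevel..|].
by move=> x /=; exact: le_lt_trans.
Qed.

Lemma distribution_fun_right_continuous (s : R) (a : \bar R) :
  (forall s' : R, (s < s')%R -> distribution_fun mu f s' <= a) ->
  distribution_fun mu f s <= a.
Proof.
move=> sa; rewrite /distribution_fun.
have -> : [set x | (s < `|f x|)%R] =
    \bigcup_n [set x | (s + n.+1%:R^-1 < `|f x|)%R].
  apply/seteqP; split => [x /= sx|x [n _] /=]; last first.
    by apply: le_lt_trans; rewrite lerDl invr_ge0.
  exists (Num.trunc (`|f x| - s)^-1) => //=.
  by rewrite -ltrBrDl invf_plt ?posrE ?subr_gt0// truncnS_gt.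
apply: bigcup_measure_le => [n|n m nm x /=|n]; first exact: measurable_superlevel.
  by apply: le_lt_trans; rewrite lerD2l lef_pV2 ?posrE ?ltr0n// ler_nat.
by apply: sa; rewrite ltrDl invr_gt0.
Qed.

Lemma rearrangement_ge0 (u : R) : 0 <= rearrangement mu f u.
Proof. by apply: le_ereal_inf_tmp => _ [s [s0 _] <-]; rewrite lee_fin. Qed.

(** The rearrangement is the generalized inverse of the distribution function:
    right continuity of the latter makes this an equivalence. *)
Lemma rearrangement_gtP (s u : R) : (0 <= s)%R ->
  (s%:E < rearrangement mu f u) = (u%:E < distribution_fun mu f s).
Proof.
move=> s0; apply/idP/idP; last first.
  rewrite !ltNge; apply: contra => rs.
  apply: distribution_fun_right_continuous => s' ss'.
  have : rearrangement mu f u < s'%:E by rewrite (le_lt_trans rs)// lte_fin.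
  move=> /ereal_inf_lt[_ [c [c0 cu] <-]]; rewrite lte_fin => /ltW cs'.
  by apply: le_trans cu; exact: distribution_fun_noninc.
rewrite !ltNge; apply: contra => su; apply: ereal_inf_lbound.
by exists s.
Qed.

Lemma rearrangement_noninc (u v : R) : (u <= v)%R ->
  rearrangement mu f v <= rearrangement mu f u.
Proof.
move=> uv; apply: le_ereal_inf_tmp => _ [s [s0 su] <-].
apply: ereal_inf_lbound; exists s => //; split => //.
by apply: le_trans su _; rewrite lee_fin.
Qed.

End rearrangement_theory.

Section riemann_sums.
Context (R : realType).
Local Notation leb := (@lebesgue_measure R).
Variable p : R -> R.
Hypothesis p_ge0 : forall u, (0 <= p u)%R.
Hypothesis p_noninc : forall u v : R, (0 < u)%R -> (u <= v)%R -> (p v <= p u)%R.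

Let measurable_p (e : R) (A : set R) : (0 < e)%R -> measurable A ->
  A `<=` `[e, +oo[ -> measurable_fun A (EFin \o p).
Proof.
move=> e0 mA Ae; apply/measurable_EFinP.
apply: (@eq_measurable_fun _ _ _ _ _ (fun u => p (Num.max e u))).
  move=> u /set_mem /Ae /=; rewrite in_itv /= andbT => eu.
  by congr p; apply/max_idPr.
apply: measurable_funTS; apply: nonincreasing_measurable => // u v uv.
by apply: p_noninc; rewrite ?lt_max ?e0// ge_max !le_max lexx uv !orbT.
Qed.

Let step_bound (e : R) (m : nat) : (0 < e)%R ->
  \int[leb]_(u in `[e, (m.+1%:R * e)%R[) (p u)%:E <=
  (e * \sum_(i < m) p (i.+1%:R * e))%:E.
Proof.
move=> e0; elim: m => [|m IH].
  by rewrite mul1r set_itvxx big_ord0 mulr0 integral_set0.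
rewrite (_ : `[e, (m.+2%:R * e)%R[%classic =
    `[e, (m.+1%:R * e)%R[%classic `|` `[(m.+1%:R * e)%R, (m.+2%:R * e)%R[%classic); last first.
  rewrite -itv_bndbnd_setU// !bnd_simp.
    by rewrite ler_peMl ?ler1n ?(ltW e0).
  by rewrite ler_pM2r// ler_nat.
rewrite ge0_integral_setU//=.
- rewrite big_ord_recr/= mulrDr EFinD leeD//.
  apply: (@le_trans _ _ (\int[leb]_(u in `[(m.+1%:R * e)%R, (m.+2%:R * e)%R[) (cst (p (m.+1%:R * e)%R)%:E u))).
    apply: ge0_le_integral => //=.
    + by move=> u _; rewrite lee_fin.
    + apply: (@measurable_p (m.+1%:R * e)%R); rewrite ?mulr_gt0//.
      by move=> u /=; rewrite !in_itv/= andbT => /andP[].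
    + by move=> u; rewrite in_itv/= lee_fin => /andP[mu _]; rewrite p_noninc ?mulr_gt0.
  rewrite integral_cst//= lebesgue_measure_itv/= lte_fin ltr_pM2r// ltr_nat ltnSn.
  by rewrite -EFinD -EFinM lee_fin -mulrBl -natrB// subSnn mul1r mulrC.
- apply: (@measurable_p e) => //; first exact: measurableU.
  move=> u [|] /=; rewrite !in_itv/= andbT => /andP[eu _] //.
  by apply: le_trans eu; rewrite ler_peMl ?ler1n ?(ltW e0).
- by move=> u _; rewrite lee_fin.
- apply/disj_setPS => u /= [] /=; rewrite !in_itv/= => /andP[_ uv] /andP[+ _].
  by rewrite leNgt uv.
Qed.

(** Left-endpoint sums over `[t/(n+1), t[` bound the integral from above, and
    these intervals exhaust `]0, t[`; a singularity of p at 0 is harmless. *)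
Lemma integral_le_riemann (t A : R) : (0 < t)%R ->
  (forall n, \sum_(i < n) p (i.+1%:R * (t / n.+1%:R)) <= A * n.+1%:R)%R ->
  \int[leb]_(u in `]0%R, t[) (p u)%:E <= (t * A)%:E.
Proof.
move=> t0 pA; pose F n := `[(t / n.+1%:R)%R, t[%classic.
have tn n : (0 < t / n.+1%:R)%R by rewrite divr_gt0.
have -> : `]0%R, t[%classic = \bigcup_n F n.
  apply/seteqP; split => u; rewrite /F /= in_itv/=.
    move=> /andP[u0 ut]; exists (Num.trunc (t / u)) => //=.
    by rewrite in_itv/= ut andbT ler_pdivrMr// mulrC -ler_pdivrMr// ltW// truncnS_gt.
  by move=> [n _] /=; rewrite in_itv/= => /andP[nu ->]; rewrite (lt_le_trans _ nu).
have ndF : {homo F : n m / (n <= m)%N >-> (n <= m)%O}.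
  move=> n m nm; apply/subsetPset => u; rewrite /F /= !in_itv/= => /andP[nu ->].
  by rewrite andbT (le_trans _ nu)// ler_pM2l// lef_pV2 ?posrE// ler_nat.
have cv : \int[leb]_(u in F n) (p u)%:E @[n --> \oo] -->
    \int[leb]_(u in \bigcup_n F n) (p u)%:E.
  apply: ge0_nondecreasing_set_cvg_integral => // [n|n|n u _].
  - exact: measurable_itv.
  - apply: (@measurable_p (t / n.+1%:R)%R) => // [|u]; first exact: measurable_itv.
    by rewrite /F /= !in_itv/= andbT => /andP[].
  - by rewrite lee_fin.
rewrite -(cvg_lim _ cv)//; apply: lime_le; first exact/cvg_ex/ex_intro/cv.
apply: nearW => n; rewrite /F.
rewrite [X in `[_, X[%classic](_ : t = (n.+1%:R * (t / n.+1%:R))%R); last first.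
  by rewrite mulrC divfK.
apply: le_trans (step_bound _ (tn n)) _; rewrite lee_fin.
by rewrite mulrAC ler_pdivrMr// -mulrA ler_pM2l.
Qed.

End riemann_sums.

(** * Ideal and rearrangement properties of the quasi-norm *)

Section qri_theory.
Context (d : measure_display) (R : realType) (T : measurableType d).
Variable mu : {measure set T -> \bar R}.
Variable X : qri_space mu.

(** Monotonicity of the quasi-norm is the Fatou property for the sequence
    f, g, g, g, ... *)
Lemma qri_ideal (f g : T -> R) : measurable_fun [set: T] f ->
  (forall x, (0 <= f x <= g x)%R) -> qri_mem X g ->
  qri_mem X f /\ (qri_norm X f <= qri_norm X g)%R.
Proof.
move=> mf fg Xg; pose u n := if n is 0%N then f else g.
have mu_ n : measurable_fun [set: T] (u n).
  by case: n => [//|n]; exact: (qri_measurable Xg).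
have [] := @qri_fatou _ _ _ _ X u g mu_ _ Xg.
  apply: nearW => x; have /andP[f0 fgx] := fg x; split.
  - by case=> [//|n]; exact: le_trans fgx.
  - by case=> [|m] [|n].
  - by rewrite -cvg_shiftS /u /=; exact: cvg_cst.
by move=> Xu nu _; split; [exact: (Xu 0%N)|exact: (nu 0%N 1%N)].
Qed.

Lemma qri_equidistributed (f g : T -> R) : qri_mem X f ->
  measurable_fun [set: T] g ->
  (forall s : R, (0 <= s)%R -> distribution_fun mu f s = distribution_fun mu g s) ->
  qri_mem X g /\ qri_norm X f = qri_norm X g.
Proof.
move=> Xf mg fg; apply: qri_invariant => // t _.
congr (ereal_inf (_ @` _)); apply/seteqP; split => s /= [s0].
  by rewrite fg.
by rewrite -fg.
Qed.

End qri_theory.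

Section uniform_blocks.
Context (d : measure_display) (R : realType) (T : measurableType d).
Variable mu : {measure set T -> \bar R}.
Variable Psi : T -> R.
Hypothesis mPsi : measurable_fun [set: T] Psi.
Hypothesis PsiE : forall u : R, (0 <= u)%R -> mu [set x | (Psi x <= u)%R] = u%:E.

Definition block (a b : R) := [set x | (a < Psi x <= b)%R].

Lemma measurable_block (a b : R) : measurable (block a b).
Proof.
rewrite (_ : block a b = [set x | (a < Psi x)%R] `&` [set x | (Psi x <= b)%R]).
  apply: measurableI; first exact: measurable_set_ltr.
  exact: measurable_set_ler.
by apply/seteqP; split => x /=; [move=> /andP[]|move=> [? ?]; apply/andP].
Qed.

Lemma measure_block (a b : R) : (0 <= a)%R -> (a <= b)%R -> mu (block a b) = (b - a)%:E.
Proof.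
move=> a0 ab.
have mle c : measurable [set x | (Psi x <= c)%R] by exact: measurable_set_ler.
have E : mu [set x | (Psi x <= b)%R] = mu [set x | (Psi x <= a)%R] + mu (block a b).
  rewrite -measureU//; [congr (mu _)|exact: measurable_block|].
    apply/seteqP; split => x /=; rewrite /block /=.
      by move=> ->; rewrite andbT; case: leP => _; [left|right].
    by move=> [/le_trans|/andP[]//]; apply.
  apply/seteqP; split => // x [/= xa /andP[ax _]].
  by move: ax; rewrite ltNge xa.
move: E; rewrite !PsiE// ?(le_trans a0 ab)// => E.
by rewrite EFinB E addeAC subee ?add0e.
Qed.

(** The bound may be infinite, as superlevel sets of decreasing functions of
    Psi may have infinite measure. *)
Definition open_block (a : \bar R) := [set x | (0 < Psi x)%R /\ (Psi x)%:E < a].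

Lemma measurable_open_block a : measurable (open_block a).
Proof.
rewrite (_ : open_block a = [set x | (0 < Psi x)%R] `&` [set x | (Psi x)%:E < a])//.
apply: measurableI; first exact: measurable_set_ltr.
rewrite -[X in measurable X]setTI; apply: measurable_lte => //.
exact/measurable_EFinP.
Qed.

Lemma measure_open_block (a : \bar R) : 0 <= a -> mu (open_block a) = a.
Proof.
have ge (v : R) : (0 <= v)%R -> v%:E < a -> v%:E <= mu (open_block a).
  move=> v0 va; rewrite -[v]subr0 -measure_block//; apply: le_mu.
  - exact: measurable_block.
  - exact: measurable_open_block.
  - by move=> x /andP[x0 xv]; split => //; rewrite (le_lt_trans _ va)// lee_fin.
case: a ge => [a ge|ge _|//]; last first.
  apply/eqP; rewrite -leye_eq leNgt; apply/negP => h.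
  have := ge (fine (mu (open_block +oo)) + 1)%R; rewrite ltry.
  rewrite addr_ge0// ?fine_ge0// => /(_ isT isT).
  rewrite EFinD fineK ?ge0_fin_numE//.
  rewrite -[X in _ <= X]fineK ?ge0_fin_numE// -[X in X + _]fineK ?ge0_fin_numE//.
  rewrite -EFinD lee_fin.
  by rewrite gerDl ler10.
rewrite lee_fin => a0; apply/eqP; rewrite eq_le; apply/andP; split.
  rewrite -[X in _ <= X%:E]subr0 -measure_block//; apply: le_mu.
  - exact: measurable_open_block.
  - exact: measurable_block.
  - by move=> x [x0]; rewrite /block/= lte_fin x0 => /ltW.
apply/lee_addgt0Pr => e e0; have [ae|ea] := leP a e.
  by rewrite (le_trans (_ : _ <= e%:E)) ?lee_fin// leeDr.
by rewrite -leeBlDr// -EFinB ge ?subr_ge0 ?ltW// lte_fin gtrBl.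
Qed.

Lemma in_some_block (e y : R) (n : nat) : (0 < y <= n%:R * e)%R ->
  exists i : 'I_n, (i%:R * e < y <= i.+1%:R * e)%R.
Proof.
elim: n => [|n IH] /andP[y0 yn].
  by move: yn; rewrite mul0r leNgt y0.
have [le|lt] := leP y (n%:R * e)%R.
  have [|i ib] := IH; first by rewrite y0.
  by exists (widen_ord (leqnSn n) i).
by exists ord_max; rewrite lt yn.
Qed.

End uniform_blocks.

(** * Averaging by alpha-convexity *)

Section averaging.
Context (d : measure_display) (R : realType) (T : measurableType d).
Variable mu : {measure set T -> \bar R}.
Variable Psi : T -> R.
Hypothesis mPsi : measurable_fun [set: T] Psi.
Hypothesis PsiE : forall u : R, (0 <= u)%R -> mu [set x | (Psi x <= u)%R] = u%:E.
Variable X : qri_space mu.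

Let phi := fundamental_fun X.
Let mb := measurable_block mPsi.

Lemma fundamental_fun_block (u : R) : (0 <= u)%R ->
  phi u = qri_norm X (\1_(block Psi 0 u)).
Proof.
by move=> u0; apply: fundamental_funE => //; rewrite (measure_block mPsi PsiE)// subr0.
Qed.

Lemma block_mem (a b : R) : (0 <= a)%R -> (a <= b)%R ->
  qri_mem X (\1_(block Psi a b)).
Proof.
move=> a0 ab; apply: qri_indic => //.
by rewrite (measure_block mPsi PsiE)// ltry.
Qed.

Lemma fundamental_fun_ge0 (u : R) : (0 <= u)%R -> (0 <= phi u)%R.
Proof.
by move=> u0; rewrite fundamental_fun_block// qri_norm_ge0//; exact: block_mem.
Qed.

Lemma fundamental_fun_nd (u v : R) : (0 <= u)%R -> (u <= v)%R -> (phi u <= phi v)%R.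
Proof.
move=> u0 uv; rewrite !fundamental_fun_block ?(le_trans u0)//.
have [||//] := @qri_ideal _ _ _ _ X (\1_(block Psi 0 u)) (\1_(block Psi 0 v)) _ _ (block_mem (lexx _) (le_trans u0 uv)).
  exact: measurable_indic.
move=> x; rewrite !indicE; have [xu|xu] := boolP (x \in block Psi 0 u); last first.
  by rewrite lexx ler0n.
rewrite mem_set ?ler01 ?lexx//; move/set_mem : xu => /andP[x0 xu].
by rewrite /block /= x0 (le_trans xu).
Qed.

Lemma fundamental_fun_gt0 (u : R) : (0 < u)%R -> (0 < phi u)%R.
Proof.
move=> u0; rewrite lt_neqAle eq_sym fundamental_fun_ge0 ?ltW// andbT.
apply/eqP; rewrite fundamental_fun_block ?ltW//.
rewrite (qri_norm_eq0 (block_mem (lexx _) (ltW u0))) => -[N [mN N0 BN]].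
have : mu (block Psi 0 u) <= mu N.
  apply: le_mu => // x xu; apply: BN => /=.
  by rewrite indicE mem_set// => /eqP; rewrite oner_eq0.
by rewrite N0 (measure_block mPsi PsiE (lexx _) (ltW u0)) subr0 lee_fin leNgt u0.
Qed.

(** A function whose values are prescribed by a decreasing function of the
    uniform coordinate Psi is equidistributed with F as soon as that function
    inverts the distribution function of F. *)
Lemma qri_transplant (F : T -> R) (k : R -> R) : qri_mem X F ->
  (forall u : R, (0 <= k u)%R) ->
  (forall u : R, (u <= 0)%R -> k u = 0%R) ->
  (forall u s : R, (0 < u)%R -> (0 <= s)%R ->
    (s < k u)%R = (u%:E < distribution_fun mu F s)) ->
  qri_mem X (k \o Psi) /\ qri_norm X (k \o Psi) = qri_norm X F.
Proof.
move=> XF k0 kneg kF.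
have lev (s : R) : (0 <= s)%R -> [set x | (s < k (Psi x))%R] =
    open_block Psi (distribution_fun mu F s).
  move=> s0; apply/seteqP; split => x /=; rewrite /open_block /=.
    have [Px0|Px0] := ltP 0%R (Psi x); first by rewrite kF.
    by rewrite kneg// ltNge s0.
  by move=> [Px0]; rewrite kF.
have mk : measurable_fun [set: T] (k \o Psi).
  apply: (measurability _ (RGenOInfty.measurableE R)) => //.
  move=> _ [_ [a ->] <-]; rewrite setTI.
  rewrite (_ : _ @^-1` _ = [set x | (a < k (Psi x))%R]); last first.
    by apply/seteqP; split => x; rewrite /= in_itv /= andbT.
  have [a0|a0] := leP 0%R a.
    by rewrite lev//; exact: measurable_open_block.
  rewrite (_ : [set _ | _] = setT)//; apply/seteqP; split => // x _ /=.
  exact: lt_le_trans a0 (k0 _).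
suff h s : (0 <= s)%R -> distribution_fun mu F s = distribution_fun mu (k \o Psi) s.
  by have [? ->] := qri_equidistributed XF mk h.
move=> s0; rewrite [RHS]/distribution_fun.
rewrite (_ : [set x | _] = [set x | (s < k (Psi x))%R]); last first.
  by apply/seteqP; split => x /=; rewrite ger0_norm.
by rewrite lev// (measure_open_block mPsi PsiE)// measure_ge0.
Qed.

Section cyclic_average.
Variables (n : nat) (e : R) (a : 'I_n.+1 -> R).
Hypotheses (e0 : (0 <= e)%R) (a0 : forall i, (0 <= a i)%R).

Local Notation A i := (block Psi (i%:R * e) (i.+1%:R * e)).

(** The index i + j is a sum in the cyclic group 'I_n.+1. *)
Definition cyclic_step (j : 'I_n.+1) (x : T) : R :=
  (\sum_(i < n.+1) a (i + j) * \1_(A i) x)%R.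

Lemma block_disjoint (i i' : nat) (x : T) : block Psi (i%:R * e) (i.+1%:R * e) x ->
  block Psi (i'%:R * e) (i'.+1%:R * e) x -> i = i'.
Proof.
wlog ii : i i' / (i <= i')%N => [h xi xi'|].
  have [/h|/ltnW/h] := leqP i i'; first exact.
  by move=> /(_ xi' xi).
move=> /andP[_ x1] /andP[x2 _]; apply/eqP; rewrite eqn_leq ii/= leqNgt.
apply/negP => lt; move: x1; rewrite leNgt => /negP; apply; apply: le_lt_trans x2.
by rewrite ler_wpM2r// ler_nat.
Qed.

Lemma cyclic_step_in (i j : 'I_n.+1) x : A i x -> cyclic_step j x = a (i + j)%R.
Proof.
move=> xi; rewrite /cyclic_step (bigD1 i)//= indicE mem_set// mulr1 big1 ?addr0// => i' ii'.
rewrite indicE memNset ?mulr0// => xi'.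
by move: ii'; rewrite (val_inj (block_disjoint xi' xi)) eqxx.
Qed.

Lemma cyclic_step_out j x : (forall i : 'I_n.+1, ~ A i x) -> cyclic_step j x = 0%R.
Proof.
by move=> xA; rewrite /cyclic_step big1// => i _; rewrite indicE memNset ?mulr0.
Qed.

Lemma cyclic_step_ge0 j x : (0 <= cyclic_step j x)%R.
Proof. by apply: sumr_ge0 => i _; rewrite mulr_ge0. Qed.

Lemma measurable_cyclic_step j : measurable_fun [set: T] (cyclic_step j).
Proof.
by apply: measurable_sum => i; apply: measurable_funM => //; apply: measurable_indic; exact: mb.
Qed.

Lemma distribution_cyclic_step j (s : R) : (0 <= s)%R ->
  distribution_fun mu (cyclic_step j) s =
  \sum_(i < n.+1 | (s < a i)%R) e%:E.
Proof.
move=> s0; rewrite /distribution_fun.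
pose F m := if (s < a (inord m + j))%R then block Psi (m%:R * e) (m.+1%:R * e) else set0.
rewrite (_ : [set x | _] = \big[setU/set0]_(m < n.+1) F m).
  rewrite measure_bigsetU.
  - rewrite [RHS](reindex_inj (addIr j))/= [RHS]big_mkcond/=; apply: eq_bigr => i _.
    rewrite /F inord_val; case: ifP => _; last by rewrite measure0.
    rewrite (measure_block mPsi PsiE).
    + by rewrite -mulrBl -natrB// subSnn mul1r.
    + by rewrite mulr_ge0.
    + by rewrite ler_wpM2r// ler_nat.
  - by move=> m; rewrite /F; case: ifP => // _; exact: mb.
  - apply/trivIsetP => m m' _ _ /eqP mm'; apply/seteqP; split => // x [].
    by rewrite /F; case: ifP => // _ xm; case: ifP => // _ /(block_disjoint xm).
apply/seteqP; split => x /=; rewrite -bigcup_mkord.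
  rewrite ger0_norm ?cyclic_step_ge0//.
  have [[i xi]|/forallNP nx] := pselect (exists i : 'I_n.+1, A i x).
    rewrite (cyclic_step_in _ xi) => sa; exists i => //=.
    by rewrite /F inord_val sa.
  by rewrite cyclic_step_out// ltNge s0.
move=> [m /= mn]; rewrite /F; case: ifP => // sa xm.
by rewrite ger0_norm ?cyclic_step_ge0// (@cyclic_step_in (inord m))// inordK.
Qed.

End cyclic_average.

End averaging.

Section convex_average.
Context (d : measure_display) (R : realType) (T : measurableType d).
Variable mu : {measure set T -> \bar R}.
Variable Psi : T -> R.
Hypothesis mPsi : measurable_fun [set: T] Psi.
Hypothesis PsiE : forall u : R, (0 <= u)%R -> mu [set x | (Psi x <= u)%R] = u%:E.
Variable X : qri_space mu.
Variables alpha C : R.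
Hypotheses (alpha0 : (0 < alpha)%R) (C0 : (0 < C)%R).
Hypothesis convexC : forall (n : nat) (f : 'I_n -> T -> R),
  (forall j, qri_mem X (f j)) ->
  qri_enorm X (fun x => (\sum_(j < n) `|f j x| `^ alpha) `^ alpha^-1)%R <=
  (C * (\sum_(j < n) qri_norm X (f j) `^ alpha) `^ alpha^-1)%R%:E.

Let phi := fundamental_fun X.

Lemma qri_enormE (f : T -> R) : qri_mem X f -> qri_enorm X f = (qri_norm X f)%:E.
Proof. by move=> Xf; rewrite /qri_enorm mem_set. Qed.

(** The n+1 cyclic rearrangements of a step function are equidistributed, and
    the sum of their alpha-th powers is constant on the union of the blocks. *)
Lemma cyclic_average (n : nat) (e : R) (a : 'I_n.+1 -> R) :
  (0 <= e)%R -> (forall i, (0 <= a i)%R) ->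
  qri_mem X (cyclic_step Psi e a 0%R) ->
  ((\sum_i a i `^ alpha) `^ alpha^-1 * phi (n.+1%:R * e) <=
   C * (n.+1%:R `^ alpha^-1 * qri_norm X (cyclic_step Psi e a 0%R)))%R.
Proof.
move=> e0 a0 X0; set N0 := qri_norm X (cyclic_step Psi e a 0%R).
have N00 : (0 <= N0)%R by exact: qri_norm_ge0.
have Xj j : qri_mem X (cyclic_step Psi e a j) /\
    qri_norm X (cyclic_step Psi e a j) = N0.
  have [|? <-//] := qri_equidistributed X0 (measurable_cyclic_step mPsi e a j).
  by move=> s s0; rewrite !(distribution_cyclic_step mPsi PsiE).
have := convexC (fun j => (Xj j).1).
under eq_bigr do rewrite (Xj _).2.
have -> : ((\sum_(i < n.+1) N0 `^ alpha) `^ alpha^-1 = n.+1%:R `^ alpha^-1 * N0)%R.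
  rewrite sumr_const card_ord -[X in (X `^ _)%R]mulr_natl powRM ?powR_ge0//.
  by rewrite -powRrM mulfV ?gt_eqF// powRr1.
set V := (\sum_i a i `^ alpha)%R.
have ne0 : (0 <= n.+1%:R * e)%R by rewrite mulr_ge0.
have Xb := block_mem mPsi PsiE X (lexx 0%R) ne0.
rewrite (_ : (fun x => _) = (fun x => V `^ alpha^-1 * \1_(block Psi 0 (n.+1%:R * e)) x)%R).
  rewrite qri_enormE; last exact: qri_memZ.
  rewrite qri_normZ// ger0_norm ?powR_ge0// lee_fin.
  by rewrite -(fundamental_fun_block mPsi PsiE).
apply/funext => x; rewrite indicE.
have [|xb] := boolP (x \in block Psi 0 (n.+1%:R * e)).
  move=> /set_mem /in_some_block[i xi]; rewrite mulr1; congr (_ `^ _)%R.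
  under eq_bigr do rewrite (cyclic_step_in _ e0 _ xi) ger0_norm//.
  by rewrite [RHS](reindex_inj (addrI i)).
rewrite mulr0 big1 ?powR0 ?invr_eq0 ?gt_eqF// => j _.
rewrite cyclic_step_out ?normr0 ?powR0 ?gt_eqF// => i /andP[ix xi].
move/negP: xb; apply; rewrite inE /block /=.
rewrite (le_lt_trans _ ix) ?mulr_ge0//= (le_trans xi)//.
by rewrite ler_wpM2r// ler_nat.
Qed.

(** Sampling k at the right endpoints of n+1 equal blocks gives a step function
    below k o Psi, to which the cyclic average applies. *)
Lemma monotone_average (k : R -> R) (n : nat) (t : R) : (0 < t)%R ->
  (forall u, (0 <= k u)%R) ->
  (forall u v : R, (0 < u)%R -> (u <= v)%R -> (k v <= k u)%R) ->
  qri_mem X (k \o Psi) ->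
  ((\sum_(i < n.+1) k (i.+1%:R * (t / n.+1%:R)) `^ alpha) `^ alpha^-1 * phi t <=
   C * (n.+1%:R `^ alpha^-1 * qri_norm X (k \o Psi)))%R.
Proof.
move=> t0 k0 knoninc Xk; set e := (t / n.+1%:R)%R.
have e0 : (0 < e)%R by rewrite divr_gt0.
pose a (i : 'I_n.+1) := k (i.+1%:R * e)%R.
have a0 i : (0 <= a i)%R by exact: k0.
have [X0 le0] : qri_mem X (cyclic_step Psi e a 0%R) /\
    (qri_norm X (cyclic_step Psi e a 0%R) <= qri_norm X (k \o Psi))%R.
  apply: qri_ideal Xk; first exact: measurable_cyclic_step.
  move=> x; rewrite cyclic_step_ge0//=.
  have [[i xi]|/forallNP nx] := pselect (exists i : 'I_n.+1,
      block Psi (i%:R * e) (i.+1%:R * e) x).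
    rewrite (cyclic_step_in _ (ltW e0) _ xi) addr0; move/andP : xi => [ix xi].
    by apply: knoninc => //; apply: le_lt_trans ix; rewrite mulr_ge0// ltW.
  by rewrite cyclic_step_out.
have := cyclic_average (ltW e0) a0 X0.
rewrite (_ : n.+1%:R * e = t)%R; last by rewrite mulrC divfK.
move=> /le_trans; apply; rewrite ler_pM2l// ler_wpM2l// powR_ge0//.
Qed.

(** The cyclic average of the indicator of the first block. *)
Lemma fundamental_fun_natmul (n : nat) (u : R) : (0 <= u)%R ->
  (phi (n.+1%:R * u) <= C * (n.+1%:R `^ alpha^-1 * phi u))%R.
Proof.
move=> u0; pose a (i : 'I_n.+1) : R := (i == ord0)%:R.
have a0 i : (0 <= a i)%R by rewrite ler0n.
have E : cyclic_step Psi u a 0%R = \1_(block Psi 0 u).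
  apply/funext => x; rewrite /cyclic_step big_ord_recl /a addr0 eqxx mul1r.
  rewrite big1 ?addr0; last by move=> i _; rewrite addr0 (_ : (_ == _) = false) ?mul0r.
  by rewrite mul0r mul1r.
have := cyclic_average u0 a0; rewrite E => /(_ (block_mem mPsi PsiE X (lexx _) u0)).
rewrite -(fundamental_fun_block mPsi PsiE)//.
rewrite (_ : (\sum_i _)%R = 1%R) ?powR1 ?mul1r//.
rewrite big_ord_recl /a eqxx powR1 big1 ?addr0// => i _.
by rewrite (_ : (_ == _) = false)// powR0// gt_eqF.
Qed.

(** phi(t)^alpha / t is almost decreasing: about v / u sets of measure u cover a
    set of measure v, and alpha-convexity adds up their alpha-th powers. *)
Lemma fundamental_fun_quasiconcave (u v : R) : (0 < u)%R -> (u <= v)%R ->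
  (phi v <= C * ((2 * (v / u)) `^ alpha^-1 * phi u))%R.
Proof.
move=> u0 uv; pose n := Num.trunc (v / u).
have vu1 : (1 <= v / u)%R by rewrite ler_pdivlMr// mul1r.
apply: (@le_trans _ _ (phi (n.+1%:R * u))).
  apply: (fundamental_fun_nd mPsi PsiE); first exact: le_trans (ltW u0) uv.
  by rewrite -ler_pdivrMr// ltW// truncnS_gt.
apply: le_trans (fundamental_fun_natmul _ (ltW u0)) _.
rewrite ler_pM2l// ler_wpM2r ?(fundamental_fun_ge0 mPsi PsiE X (ltW u0))//.
apply: ge0_ler_powR; rewrite ?invr_ge0 ?nnegrE ?(ltW alpha0)//.
  by rewrite mulr_ge0// (le_trans ler01).
have /andP[+ _] := truncn_itv (le_trans ler01 vu1).
by rewrite -/n -(natr1 n); move: (v / u)%R vu1 => w; lra.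
Qed.

End convex_average.

(** * Powers and integrals *)

Section powR_inequalities.
Context (R : realType).
Implicit Types a b r s x y : R.

Lemma powRK r x : (0 < r)%R -> (0 <= x)%R -> ((x `^ r) `^ r^-1 = x)%R.
Proof. by move=> r0 x0; rewrite -powRrM mulfV ?gt_eqF// powRr1. Qed.

Lemma powRVK r x : (0 < r)%R -> (0 <= x)%R -> ((x `^ r^-1) `^ r = x)%R.
Proof. by move=> r0 x0; rewrite -powRrM mulVf ?gt_eqF// powRr1. Qed.

Lemma powR_inv r x : (0 <= x)%R -> (x^-1 `^ r = (x `^ r)^-1)%R.
Proof. by move=> x0; rewrite -powR_inv1// -powRrM mulN1r powRN. Qed.

Lemma le_powR r x y : (0 <= r)%R -> (0 <= x)%R -> (x <= y)%R -> (x `^ r <= y `^ r)%R.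
Proof.
by move=> r0 x0 xy; apply: ge0_ler_powR => //; rewrite nnegrE// (le_trans x0).
Qed.

Lemma powRV_gt r x y : (0 < r)%R -> (0 <= x)%R -> (0 <= y)%R ->
  (x < y `^ r^-1)%R = (x `^ r < y)%R.
Proof.
move=> r0 x0 y0; apply/idP/idP => h.
  by rewrite -(powRVK r0 y0) gt0_ltr_powR// nnegrE ?powR_ge0.
by rewrite -(powRK r0 x0) gt0_ltr_powR// ?nnegrE ?powR_ge0 ?invr_gt0.
Qed.

Lemma powR_subadditive r a b : (0 < r)%R -> (r <= 1)%R -> (0 <= a)%R -> (0 <= b)%R ->
  ((a + b) `^ r <= a `^ r + b `^ r)%R.
Proof.
move=> r0 r1; wlog ab : a b / (a + b = 1)%R => [h a0 b0|a0 b0].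
  have [ab|ab] := eqVneq (a + b)%R 0%R.
    by rewrite ab powR0 ?gt_eqF// addr_ge0 ?powR_ge0.
  have ab0 : (0 < a + b)%R by rewrite lt_neqAle eq_sym ab addr_ge0.
  have := h (a / (a + b))%R (b / (a + b))%R.
  rewrite -mulrDl divff// => /(_ erefl); rewrite !divr_ge0 ?(ltW ab0)// => /(_ isT isT).
  rewrite powR1 !powRM ?invr_ge0 ?(ltW ab0)// -mulrDl.
  rewrite -powR_inv1 ?(ltW ab0)// -powRrM mulN1r powRN.
  by rewrite ler_pdivlMr ?powR_gt0// mul1r.
have le_self c : (0 <= c)%R -> (c <= 1)%R -> (c <= c `^ r)%R.
  rewrite le_eqVlt => /predU1P[<-|c0] c1; first by rewrite powR_ge0.
  by apply: ger1_powR => //; rewrite c0.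
have [a1 b1] : (a <= 1 /\ b <= 1)%R by move: ab a0 b0; clear; split; lra.
by rewrite ab powR1 -{1}ab lerD// le_self.
Qed.

Lemma powR_dist r a b : (0 < r)%R -> (r <= 1)%R ->
  (`|a| `^ r - `|b| `^ r <= `|a - b| `^ r)%R.
Proof.
move=> r0 r1; rewrite lerBlDr; apply: le_trans (powR_subadditive r0 r1 _ _) => //.
by apply: le_powR => //; rewrite ?(ltW r0)// -{1}(subrK b a) ler_normD.
Qed.

Lemma powRV_add_le r a b : (0 < r)%R -> (0 <= a)%R -> (0 <= b)%R ->
  ((a + b) `^ r^-1 <= 2 `^ r^-1 * (a `^ r^-1 + b `^ r^-1))%R.
Proof.
move=> r0 a0 b0; apply: (@le_trans _ _ ((2 * Num.max a b) `^ r^-1)%R).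
  apply: le_powR; rewrite ?invr_ge0 ?(ltW r0) ?addr_ge0//.
  by rewrite mulr_natl mulr2n lerD// le_max lexx ?orbT.
rewrite powRM// ?le_max ?a0// ler_pM2l ?powR_gt0//.
by case: (leP a b) => _; rewrite ?lerDl ?lerDr powR_ge0.
Qed.

Lemma measurable_fun_powR d (T : measurableType d) (f : T -> R) r :
  measurable_fun [set: T] f -> measurable_fun [set: T] (fun z => f z `^ r)%R.
Proof. by move=> mf; apply: (measurableT_comp (measurable_powR r)). Qed.

End powR_inequalities.

Section integral_bounds.
Context (d : measure_display) (R : realType) (T : measurableType d).
Variable mu : {measure set T -> \bar R}.

(** The integral of a nonnegative function is a supremum over the simple
    functions below it, so it is monotone without any measurability. *)
Lemma le_integral_ge0 (D : set T) (f g : T -> \bar R) :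
  (forall x, D x -> 0 <= f x) -> (forall x, D x -> f x <= g x) ->
  \int[mu]_(x in D) f x <= \int[mu]_(x in D) g x.
Proof.
move=> f0 fg; rewrite !ge0_integralE//; last first.
  by move=> x Dx; exact: le_trans (f0 _ Dx) (fg _ Dx).
apply: ge_ereal_sup => _ [h hf <-]; apply: ereal_sup_ubound; exists h => // x.
apply: le_trans (hf x) _; rewrite !patchE; case: ifPn => // /set_mem; exact: fg.
Qed.

Lemma chebyshev_integral (w : T -> R) (c : R) : measurable_fun [set: T] w ->
  (forall x, (0 <= w x)%R) -> (0 <= c)%R ->
  c%:E * mu [set x | (c <= w x)%R] <= \int[mu]_x (w x)%:E.
Proof.
move=> mw w0 c0; have mS : measurable [set x | (c <= w x)%R].
  exact: measurable_set_ler.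
rewrite -integral_cst// integral_mkcond; apply: le_integral_ge0 => x _.
  by rewrite patchE; case: ifP => // _; rewrite lee_fin.
by rewrite patchE; case: ifPn => [/set_mem /=|_]; rewrite lee_fin.
Qed.

(** Summation by parts in disguise: peeling the least level off w gains
    q_n (n+1) e and leaves the same problem for n levels. *)
Lemma layer_sum_le_integral (n : nat) (q : nat -> R) (w : T -> R) (e : R) :
  measurable_fun [set: T] w -> (forall x, (0 <= w x)%R) -> (0 <= e)%R ->
  (forall i, (0 <= q i)%R) -> (forall i j, (i <= j)%N -> (q j <= q i)%R) ->
  (forall i, (i.+1%:R * e)%:E <= mu [set x | (q i <= w x)%R]) ->
  (e * \sum_(i < n) q i)%:E <= \int[mu]_x (w x)%:E.
Proof.
elim: n q w => [|n IH] q w mw w0 e0 q0 qd qm.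
  by rewrite big_ord0 mulr0; apply: integral_ge0 => x _; rewrite lee_fin.
pose c := q n; pose w' x := Num.max (w x - c)%R 0%R.
have mw' : measurable_fun [set: T] w'.
  by apply: measurable_maxr => //; exact: measurable_funB.
pose q' i := if (i < n)%N then (q i - c)%R else 0%R.
have mS : measurable [set x | (c <= w x)%R] by exact: measurable_set_ler.
have IHn : (e * \sum_(i < n) q' i)%:E <= \int[mu]_x (w' x)%:E.
  apply: IH => // [x|i|i j ij|i].
  - by rewrite le_max lexx orbT.
  - by rewrite /q'; case: ifP => // /ltnW /qd; rewrite subr_ge0.
  - rewrite /q'; case: ifP => jn; case: ifP => // in_.
    + by rewrite lerB// qd.
    + by move: in_; rewrite (leq_ltn_trans ij jn).
    + by rewrite subr_ge0 qd// ltnW.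
  - apply: le_trans (qm i) _; apply: le_mu; [exact: measurable_set_ler..|].
    move=> x /= qw; rewrite /q' /w' le_max; case: ifP => _; last by rewrite lexx orbT.
    by rewrite lerD2r qw.
apply: (@le_trans _ _ (\int[mu]_x ((w' x)%:E + (cst c%:E \_ [set x | (c <= w x)%R]) x))).
  rewrite ge0_integralD//; last 4 first.
  - by move=> x _; rewrite lee_fin le_max lexx orbT.
  - exact/measurable_EFinP.
  - by move=> x _; rewrite patchE; case: ifP => // _; rewrite lee_fin /c.
  - exact/(measurable_restrictT _ _).1.
  rewrite -integral_mkcond integral_cst//.
  apply: (@le_trans _ _ ((e * \sum_(i < n) q' i)%:E + c%:E * (n.+1%:R * e)%:E)); last first.
    apply: leeD => //; apply: lee_wpmul2l; rewrite ?lee_fin//; exact: q0.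
  rewrite -EFinM -EFinD lee_fin big_ord_recr/= -/c.
  have -> : (\sum_(i < n) q' i = \sum_(i < n) q i - n%:R * c)%R.
    transitivity (\sum_(i < n) (q i - c))%R.
      by apply: eq_bigr => i _; rewrite /q' ltn_ord.
    by rewrite sumrB sumr_const card_ord mulr_natl.
  by rewrite -(natr1 n); move: (\sum_(i < n) q i)%R (n%:R)%R => S k; lra.
apply: le_integral_ge0 => x _.
  rewrite adde_ge0 ?lee_fin ?le_max ?lexx ?orbT// patchE.
  by case: ifP => // _; rewrite lee_fin /c.
rewrite patchE; case: ifPn => [/set_mem /= cw|]; rewrite /w'.
  by rewrite max_l ?subr_ge0// -EFinD subrK.
rewrite notin_setE /= => /negP; rewrite -ltNge => /ltW wc.
by rewrite max_r ?subr_le0// adde0 lee_fin.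
Qed.

End integral_bounds.

(** * Rearrangements of dominated functions *)

Section finite_rearrangement.
Context (d : measure_display) (R : realType) (T : measurableType d).
Variables (mu : {measure set T -> \bar R}) (g : T -> R).
Hypothesis g_lty : forall u : R, (0 < u)%R -> rearrangement mu g u < +oo.

(** The cut-off at 0 is where the rearrangement may be infinite. *)
Definition rearrangement_fine (u : R) :=
  if (0 < u)%R then fine (rearrangement mu g u) else 0%R.
Local Notation p := rearrangement_fine.

Lemma rearrangement_fineE (u : R) : (0 < u)%R -> (p u)%:E = rearrangement mu g u.
Proof.
move=> u0; rewrite /p u0 fineK// ge0_fin_numE ?rearrangement_ge0//.
exact: g_lty.
Qed.

Lemma rearrangement_fine_ge0 (u : R) : (0 <= p u)%R.
Proof.
by rewrite /p; case: ifP => // u0; rewrite fine_ge0// rearrangement_ge0.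
Qed.

Lemma rearrangement_fine_noninc (u v : R) : (0 < u)%R -> (u <= v)%R -> (p v <= p u)%R.
Proof.
move=> u0 uv; rewrite -lee_fin !rearrangement_fineE// ?(lt_le_trans u0)//.
exact: rearrangement_noninc.
Qed.

Lemma rearrangement_integral_le_riemann (t A : R) : (0 < t)%R ->
  (forall n, \sum_(i < n) p (i.+1%:R * (t / n.+1%:R)) <= A * n.+1%:R)%R ->
  \int[lebesgue_measure]_(u in `]0%R, t[) rearrangement mu g u <= (t * A)%:E.
Proof.
move=> t0 h; apply: le_trans (integral_le_riemann _ _ t0 h); last 2 first.
- exact: rearrangement_fine_ge0.
- exact: rearrangement_fine_noninc.
apply: le_integral_ge0 => u /=; first by rewrite rearrangement_ge0.
by rewrite in_itv /= => /andP[u0 _]; rewrite rearrangement_fineE.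
Qed.

End finite_rearrangement.

Section domination.
Context (d : measure_display) (R : realType) (T : measurableType d).
Variable mu : {measure set T -> \bar R}.
Hypothesis mu_infinite : mu [set: T] = +oo.
Variables (g w : T -> R) (I c : R).
Hypotheses (mg : measurable_fun [set: T] g) (mw : measurable_fun [set: T] w).
Hypotheses (w0 : forall x, (0 <= w x)%R) (c0 : (0 <= c)%R).
Hypothesis wI : \int[mu]_x (w x)%:E = I%:E.
Hypothesis gwc : \forall x \ae mu, (`|g x| <= w x + c)%R.

Let I0 : (0 <= I)%R.
Proof. by rewrite -lee_fin -wI; apply: integral_ge0 => x _; rewrite lee_fin. Qed.

Lemma dominated_distribution (s : R) :
  distribution_fun mu g (s + c) <= mu [set x | (s <= w x)%R].
Proof.
have [N [mN N0 gN]] := gwc.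
have mS : measurable [set x | (s <= w x)%R] by exact: measurable_set_ler.
rewrite -[leRHS]adde0 -N0; apply: (@le_trans _ _ (mu ([set x | (s <= w x)%R] `|` N))).
  apply: le_mu; [exact: measurable_superlevel|exact: measurableU|].
  move=> x /= sg; have [Nx|Nx] := pselect (N x); [by right|left => /=].
  have {Nx} gx : (`|g x| <= w x + c)%R by apply: contrapT => h; exact/Nx/gN.
  by rewrite /= -(lerD2r c) ltW// (lt_le_trans sg).
exact: measureU2.
Qed.

Lemma dominated_rearrangement_lty (u : R) : (0 < u)%R -> rearrangement mu g u < +oo.
Proof.
move=> u0; pose s := ((I + 1) / u)%R.
have s0 : (0 < s)%R by rewrite divr_gt0// ltr_wpDl.
apply: (@le_lt_trans _ _ (s + c)%:E); last by rewrite ltry.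
apply: ereal_inf_lbound; exists (s + c)%R => //; split.
  by rewrite addr_ge0// ltW.
apply: le_trans (dominated_distribution s) _.
have := chebyshev_integral mu mw w0 (ltW s0); rewrite wI => h.
rewrite -(@lee_pmul2l _ s%:E)//; apply: (le_trans h).
by rewrite -EFinM /s divfK ?gt_eqF// lee_fin lerDl.
Qed.

Let p := rearrangement_fine mu g.

(** The Riemann sums of the excess of the rearrangement over c are layer sums
    for w. Since rearrangement_gtP wants strict inequalities, the levels are
    lowered by e / t, which costs e in the integral. *)
Lemma dominated_rearrangement_integral (t : R) : (0 < t)%R ->
  \int[lebesgue_measure]_(u in `]0%R, t[) rearrangement mu g u <= (I + t * c)%:E.
Proof.
move=> t0; apply/lee_addgt0Pr => e e0.
rewrite -EFinD (_ : I + t * c + e = t * (I / t + c + e / t))%R; last first.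
  by rewrite !mulrDr ![(t * (_ / t))%R]mulrC !divfK ?gt_eqF.
apply: rearrangement_integral_le_riemann => // [|n].
  exact: dominated_rearrangement_lty.
rewrite -/p; set h := (t / n.+1%:R)%R; have h0 : (0 < h)%R by rewrite divr_gt0.
pose q i : R := Num.max (p (i.+1%:R * h) - (c + e / t))%R 0%R.
have ub : (h * \sum_(i < n) q i <= I)%R.
  rewrite -lee_fin -wI; apply: layer_sum_le_integral => //.
  - exact: ltW.
  - by move=> i; rewrite le_max lexx orbT.
  - move=> i j ij; rewrite ge_max !le_max lexx orbT andbT lerD2r.
    apply/orP; left; apply: (rearrangement_fine_noninc dominated_rearrangement_lty).
      by rewrite mulr_gt0.
    by rewrite ler_pM2r// ler_nat.
  move=> i; rewrite /q; have [le|gt] := leP (p (i.+1%:R * h) - (c + e / t))%R 0%R.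
    by rewrite (_ : [set _ | _] = setT) ?mu_infinite ?leey//; apply/seteqP; split => // x _ /=.
  apply: le_trans (dominated_distribution _).
  set s := (_ + c)%R; apply/ltW; rewrite -rearrangement_gtP//.
    rewrite -(rearrangement_fineE dominated_rearrangement_lty) ?mulr_gt0// -/p lte_fin /s.
    have : (0 < e / t)%R by rewrite divr_gt0.
    by move: (p _) => P; lra.
  by rewrite addr_ge0// ltW.
have pq : (\sum_(i < n) p (i.+1%:R * h) <=
    \sum_(i < n) (q i + (c + e / t)))%R.
  by apply: ler_sum => i _; rewrite -lerBlDr le_max lexx.
apply: (le_trans pq); rewrite big_split/= sumr_const card_ord -[X in (_ + X <= _)%R]mulr_natl.
have -> : ((I / t + c + e / t) * n.+1%:R = I / h + n.+1%:R * (c + e / t))%R.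
  by rewrite /h invf_div; ring.
apply: lerD; first by rewrite ler_pdivlMr// mulrC.
by rewrite ler_wpM2r ?ler_nat// addr_ge0// divr_ge0// ltW.
Qed.

End domination.

(** * Bounds for the oscillation *)

Section oscillation_bounds.
Context (d : measure_display) (R : realType) (T : measurableType d).
Variables (mu : {measure set T -> \bar R}) (g : T -> R).
Hypothesis mg : measurable_fun [set: T] g.
Hypothesis g_lty : forall u : R, (0 < u)%R -> rearrangement mu g u < +oo.

Local Notation p := (rearrangement_fine mu g).

Lemma oscillation_ge0 (t : R) : (0 < t)%R -> 0 <= oscillation mu g t.
Proof.
move=> t0; rewrite /oscillation -(rearrangement_fineE g_lty t0) leeBrDl// adde0.
rewrite /maximal_rearrangement.
have -> : (p t)%:E = (t^-1)%:E * \int[lebesgue_measure]_(u in `]0%R, t[) (cst (p t)%:E u).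
  rewrite integral_cst//= lebesgue_measure_itv/= lte_fin t0 sube0 -!EFinM.
  by rewrite mulrCA mulVf ?mulr1// gt_eqF.
apply: lee_wpmul2l; first by rewrite lee_fin invr_ge0 ltW.
apply: le_integral_ge0 => u /=; first by rewrite lee_fin rearrangement_fine_ge0.
rewrite in_itv/= => /andP[_ /ltW ut].
by rewrite (rearrangement_fineE g_lty t0); exact: rearrangement_noninc.
Qed.

Lemma oscillation_le (t A : R) : (0 < t)%R ->
  \int[lebesgue_measure]_(u in `]0%R, t[) rearrangement mu g u <=
    (t * (A + p t))%:E ->
  oscillation mu g t <= A%:E.
Proof.
move=> t0 h; rewrite /oscillation -(rearrangement_fineE g_lty t0) leeBlDr//.
rewrite /maximal_rearrangement -(@lee_pmul2l _ t%:E)// muleA -EFinM.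
by rewrite mulfV ?gt_eqF// mul1e -EFinD -EFinM.
Qed.

End oscillation_bounds.

Section oscillation_by_average.
Context (d : measure_display) (R : realType) (T : measurableType d).
Variable mu : {measure set T -> \bar R}.
Variable Psi : T -> R.
Hypothesis mPsi : measurable_fun [set: T] Psi.
Hypothesis PsiE : forall u : R, (0 <= u)%R -> mu [set x | (Psi x <= u)%R] = u%:E.
Variable X : qri_space mu.
Variables alpha C : R.
Hypotheses (alpha0 : (0 < alpha)%R) (C0 : (0 < C)%R).
Hypothesis convexC : forall (n : nat) (f : 'I_n -> T -> R),
  (forall j, qri_mem X (f j)) ->
  qri_enorm X (fun x => (\sum_(j < n) `|f j x| `^ alpha) `^ alpha^-1)%R <=
  (C * (\sum_(j < n) qri_norm X (f j) `^ alpha) `^ alpha^-1)%R%:E.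
Variable g : T -> R.
Hypotheses (mg : measurable_fun [set: T] g) (g_ge0 : forall x, (0 <= g x)%R).
Hypothesis g_lty : forall u : R, (0 < u)%R -> rearrangement mu g u < +oo.

Local Notation p := (rearrangement_fine mu g).

(** The function (g^* - g^*(t))_+ o Psi is equidistributed with the truncation
    (g - g^*(t))_+, so averaging it bounds its mean over ]0, t[, which is the
    oscillation, by the quasi-norm of the truncation. *)
Lemma oscillation_average (t : R) (G : T -> R) : (0 < t)%R -> qri_mem X G ->
  (forall x, (0 <= G x)%R) ->
  (forall x, (g x - p t <= 2 * G x `^ alpha)%R) ->
  oscillation mu g t `^ alpha^-1 * (fundamental_fun X t)%:E <=
  (C * (2 `^ alpha^-1 * qri_norm X G))%:E.
Proof.
move=> t0 XG G0 gG; set lam := p t in gG *.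
have lam0 : (0 <= lam)%R by exact: rearrangement_fine_ge0.
pose F x := (Num.max (g x - lam) 0 `^ alpha^-1)%R.
have mF : measurable_fun [set: T] F.
  apply: measurable_fun_powR.
  by apply: measurable_maxr => //; exact: measurable_funB.
have max0 (y : R) : (0 <= Num.max y 0)%R by rewrite le_max lexx orbT.
have [XF leF] : qri_mem X F /\ (qri_norm X F <= 2 `^ alpha^-1 * qri_norm X G)%R.
  rewrite -[X in (_ <= X * _)%R]ger0_norm ?powR_ge0// -qri_normZ//.
  apply: qri_ideal => // [x|]; last exact: qri_memZ.
  rewrite powR_ge0/= /F -[X in (_ <= _ * X)%R](powRK alpha0)// -powRM ?powR_ge0//.
  apply: le_powR; rewrite ?invr_ge0 ?(ltW alpha0)//.
  by rewrite ge_max gG mulr_ge0// powR_ge0.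
pose k u := if (0 < u)%R then (Num.max (p u - lam) 0 `^ alpha^-1)%R else 0%R.
have k0 u : (0 <= k u)%R by rewrite /k; case: ifP => // _; exact: powR_ge0.
have knoninc (u v : R) : (0 < u)%R -> (u <= v)%R -> (k v <= k u)%R.
  move=> u0 uv; rewrite /k u0 (lt_le_trans u0 uv); apply: le_powR => //.
    by rewrite invr_ge0 ltW.
  by rewrite ge_max !le_max lexx orbT andbT lerD2r rearrangement_fine_noninc.
have [||Xk nk] := @qri_transplant _ _ _ _ _ mPsi PsiE X F k XF k0.
- by move=> u; rewrite /k; case: ltP.
- move=> u s u0 s0; rewrite /k u0 powRV_gt//.
  have sa0 : (0 <= s `^ alpha)%R by exact: powR_ge0.
  have gt_max (y : R) : (s `^ alpha < Num.max (y - lam) 0)%R = (s `^ alpha + lam < y)%R.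
    by rewrite lt_max [(_ < 0)%R]ltNge sa0 orbF ltrBrDr.
  rewrite gt_max -lte_fin rearrangement_fineE// rearrangement_gtP ?addr_ge0//.
  congr (_ < mu _); apply/seteqP; split => x /=.
    by rewrite /F !ger0_norm ?powR_ge0// powRV_gt// gt_max.
  by rewrite /F !ger0_norm ?powR_ge0// powRV_gt// gt_max.
have phi0 : (0 < fundamental_fun X t)%R by exact: (fundamental_fun_gt0 mPsi PsiE).
pose M := (C * (2 `^ alpha^-1 * qri_norm X G) / fundamental_fun X t)%R.
have M0 : (0 <= M)%R.
  by rewrite !mulr_ge0 ?powR_ge0 ?qri_norm_ge0 ?invr_ge0// ?(ltW C0) ?(ltW phi0).
suff osc : oscillation mu g t <= (M `^ alpha)%:E.
  apply: (@le_trans _ _ (M%:E * (fundamental_fun X t)%:E)); last first.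
    by rewrite -EFinM /M divfK// gt_eqF.
  apply: lee_wpmul2r; first by rewrite lee_fin ltW.
  rewrite -[X in _ <= X%:E](powRK alpha0 M0) -poweR_EFin.
  apply: gt0_ler_poweR => //; rewrite ?in_itv/= ?andbT ?leey ?oscillation_ge0//.
    by rewrite invr_ge0 ltW.
  by rewrite lee_fin powR_ge0.
apply: oscillation_le => //; apply: rearrangement_integral_le_riemann => // n.
have N0 : (0 < n.+1%:R :> R)%R by rewrite ltr0n.
have := monotone_average mPsi PsiE alpha0 C0 convexC n t0 k0 knoninc Xk.
set h := (t / n.+1%:R)%R; have h0 : (0 < h)%R by rewrite divr_gt0.
set S := (\sum_(i < n.+1) _)%R => avg.
have S0 : (0 <= S)%R by apply: sumr_ge0 => i _; exact: powR_ge0.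
have SM : (S <= n.+1%:R * M `^ alpha)%R.
  rewrite -[leLHS](powRVK alpha0 S0) -[X in (_ <= X * _)%R](powRVK alpha0 (ltW N0)).
  rewrite -powRM ?powR_ge0//; apply: le_powR; rewrite ?(ltW alpha0) ?powR_ge0//.
  rewrite /M mulrA ler_pdivlMr//; apply: (le_trans avg).
  by rewrite nk mulrCA ler_wpM2l ?powR_ge0// ler_wpM2l ?(ltW C0).
apply: (@le_trans _ _ (S + n.+1%:R * lam)%R); last first.
  by rewrite [leRHS]mulrC mulrDr lerD2r.
rewrite -[X in (_ + X)%R](_ : \sum_(i < n.+1) lam = _)%R; last first.
  by rewrite sumr_const card_ord mulr_natl.
rewrite -big_split/= big_ord_recr/= -[leLHS]addr0 lerD//; last first.
  by rewrite addr_ge0// powR_ge0.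
apply: ler_sum => i _; rewrite /k ifT ?mulr_gt0// powRVK//.
by rewrite -lerBlDr le_max lexx.
Qed.

End oscillation_by_average.

(** * The space L^alpha + L^oo *)

Section sum_space_theory.
Context (d : measure_display) (R : realType) (T : measurableType d).
Variable mu : {measure set T -> \bar R}.
Hypothesis mu_infinite : mu [set: T] = +oo.
Variable alpha : R.
Hypotheses (alpha0 : (0 < alpha)%R) (alpha1 : (alpha <= 1)%R).
Variables (f : T -> R) (h : (T -> R) * (T -> R)).
Hypothesis fh : sum_decomposition f h.

Let w x := (`|h.1 x| `^ alpha)%R.

Let w0 x : (0 <= w x)%R. Proof. exact: powR_ge0. Qed.

Let mw : measurable_fun [set: T] w.
Proof.
by have [m1 _ _] := fh; apply: measurable_fun_powR; exact: measurableT_comp.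
Qed.

Lemma measurable_sum_decomposition : measurable_fun [set: T] f.
Proof.
have [m1 m2 fE] := fh; rewrite (_ : f = (fun x => h.1 x + h.2 x)%R).
  exact: measurable_funD.
exact/funext.
Qed.

Lemma measurable_abs_powR : measurable_fun [set: T] (fun x => `|f x| `^ alpha)%R.
Proof.
apply: measurable_fun_powR; apply: measurableT_comp => //.
exact: measurable_sum_decomposition.
Qed.

(** Subadditivity of the alpha-th power splits |f|^alpha into an integrable part
    and a bounded part. *)
Lemma sum_decomposition_domination :
  finite_norm mu alpha%:E h.1 -> finite_norm mu +oo h.2 ->
  exists I M : R, [/\ (0 <= I)%R /\ (0 <= M)%R, \int[mu]_x (w x)%:E = I%:E,
    'N[mu]_(alpha%:E)[EFin \o h.1] = (I `^ alpha^-1)%:E,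
    'N[mu]_(+oo)[EFin \o h.2] = M%:E &
    \forall x \ae mu, (`| `|f x| `^ alpha| <= w x + M `^ alpha)%R].
Proof.
move=> fin1 fin2; have [m1 m2 fE] := fh.
have Iw : \int[mu]_x `|(EFin \o h.1) x| `^ alpha = \int[mu]_x (w x)%:E.
  by apply: eq_integral.
have Iw0 : 0 <= \int[mu]_x (w x)%:E.
  by apply: integral_ge0 => x _; rewrite lee_fin.
have Ifin : \int[mu]_x (w x)%:E < +oo.
  have := fin1; rewrite /finite_norm unlock Iw => /lty_poweRy; apply.
  by rewrite invr_eq0 gt_eqF.
have N2 : 0 <= 'N[mu]_(+oo)[EFin \o h.2] by exact: Lnorm_ge0.
pose M := fine ('N[mu]_(+oo)[EFin \o h.2]).
have ME : 'N[mu]_(+oo)[EFin \o h.2] = M%:E by rewrite /M fineK// ge0_fin_numE.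
have M0 : (0 <= M)%R by rewrite fine_ge0.
have IE : \int[mu]_x (w x)%:E = (fine (\int[mu]_x (w x)%:E))%:E.
  by rewrite fineK// ge0_fin_numE.
exists (fine (\int[mu]_x (w x)%:E)), M; split => //; first by rewrite fine_ge0.
  by rewrite unlock Iw {1}IE poweR_EFin.
have h2M : \forall x \ae mu, (`|h.2 x| <= M)%R.
  have := ess_sup_ge mu (abse \o (EFin \o h.2)).
  move: ME; rewrite unlock mu_infinite ltry => ->.
  by apply: filterS => x /=; rewrite lee_fin.
apply: filterS h2M => x h2x; rewrite ger0_norm ?powR_ge0// fE.
apply: (@le_trans _ _ ((`|h.1 x| + M) `^ alpha)%R); last exact: powR_subadditive.
apply: le_powR => //; first exact: ltW.
by apply: le_trans (ler_normD _ _) _; rewrite lerD2l.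
Qed.

Lemma sum_decomposition_rearrangement_lty :
  finite_norm mu alpha%:E h.1 -> finite_norm mu +oo h.2 ->
  forall u : R, (0 < u)%R ->
    rearrangement mu (fun x => `|f x| `^ alpha)%R u < +oo.
Proof.
move=> fin1 fin2 u u0.
have [I [M [[I0 M0] IE _ _ dom]]] := sum_decomposition_domination fin1 fin2.
exact: (dominated_rearrangement_lty measurable_abs_powR mw w0 (powR_ge0 _ _) IE dom).
Qed.

Lemma oscillation_le_decomposition (t : R) : (0 < t)%R -> (t <= 1)%R ->
  finite_norm mu alpha%:E h.1 -> finite_norm mu +oo h.2 ->
  oscillation mu (fun x => `|f x| `^ alpha)%R t `^ alpha^-1 <=
  (2 `^ alpha^-1 * t^-1 `^ alpha^-1)%:E *
  ('N[mu]_(alpha%:E)[EFin \o h.1] + 'N[mu]_(+oo)[EFin \o h.2]).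
Proof.
move=> t0 t1 fin1 fin2; set g := fun x => (`|f x| `^ alpha)%R.
have g_lty := sum_decomposition_rearrangement_lty fin1 fin2.
have [I [M [[I0 M0] IE NI NM dom]]] := sum_decomposition_domination fin1 fin2.
have mg : measurable_fun [set: T] g by exact: measurable_abs_powR.
have osc : oscillation mu g t <= (I / t + M `^ alpha)%:E.
  apply: (oscillation_le g_lty) => //.
  have := dominated_rearrangement_integral mu_infinite mg mw w0 (powR_ge0 _ _) IE dom t0.
  move=> /le_trans; apply; rewrite lee_fin !mulrDr mulrCA mulfV ?gt_eqF// mulr1.
  by rewrite lerDl mulr_ge0 ?rearrangement_fine_ge0// ltW.
have a10 : (0 <= alpha^-1)%R by rewrite invr_ge0 ltW.
have It0 : (0 <= I / t)%R by rewrite divr_ge0// ltW.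
apply: (@le_trans _ _ ((I / t + M `^ alpha) `^ alpha^-1)%:E).
  rewrite -poweR_EFin; apply: gt0_ler_poweR => //.
    by rewrite in_itv/= leey oscillation_ge0.
  by rewrite in_itv/= leey lee_fin addr_ge0// powR_ge0.
rewrite NI NM -EFinD -EFinM lee_fin.
apply: le_trans (powRV_add_le alpha0 It0 (powR_ge0 _ _)) _.
rewrite -mulrA ler_pM2l ?powR_gt0// mulrDr powRK// powRM ?invr_ge0 ?(ltW t0)//.
rewrite [X in (X + _ <= _)%R]mulrC lerD2l ler_peMl//.
have -> : (1 = 1 `^ alpha^-1 :> R)%R by rewrite powR1.
by apply: le_powR => //; rewrite invf_ge1.
Qed.

End sum_space_theory.

Section sum_norm_bound.
Context (d : measure_display) (R : realType) (T : measurableType d).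
Variable mu : {measure set T -> \bar R}.
Hypothesis mu_infinite : mu [set: T] = +oo.
Variable alpha : R.
Hypotheses (alpha0 : (0 < alpha)%R) (alpha1 : (alpha <= 1)%R).

Lemma oscillation_le_sum_norm (f : T -> R) (t : R) : (0 < t)%R -> (t <= 1)%R ->
  oscillation mu (fun x => `|f x| `^ alpha)%R t `^ alpha^-1 <=
  (2 `^ alpha^-1 * t^-1 `^ alpha^-1)%:E * sum_norm mu alpha f.
Proof.
move=> t0 t1; set K := (2 `^ alpha^-1 * t^-1 `^ alpha^-1)%R.
have K0 : (0 < K)%R by rewrite mulr_gt0// powR_gt0// invr_gt0.
rewrite -lee_pdivrMl//; apply: le_ereal_inf_tmp => _ [h fh <-].
rewrite lee_pdivrMl//.
have N1 : 0 <= 'N[mu]_(alpha%:E)[EFin \o h.1] by exact: Lnorm_ge0.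
have N2 : 0 <= 'N[mu]_(+oo)[EFin \o h.2] by exact: Lnorm_ge0.
have [fin1|] := boolP ('N[mu]_(alpha%:E)[EFin \o h.1] < +oo); last first.
  rewrite -leNgt leye_eq => /eqP ->; rewrite addye ?gt0_muley ?leey//.
  by rewrite gt_eqF// (lt_le_trans _ N2).
have [fin2|] := boolP ('N[mu]_(+oo)[EFin \o h.2] < +oo); last first.
  rewrite -leNgt leye_eq => /eqP ->; rewrite addey ?gt0_muley ?leey//.
  by rewrite gt_eqF// (lt_le_trans _ N1).
exact: oscillation_le_decomposition.
Qed.

Lemma sum_norm_ge0 (f : T -> R) : 0 <= sum_norm mu alpha f.
Proof.
by apply: le_ereal_inf_tmp => _ [h _ <-]; rewrite adde_ge0// Lnorm_ge0.
Qed.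

End sum_norm_bound.

(** * The gradient controls the oscillation *)

Section gradient_bounds.
Context (d : measure_display) (R : realType) (T : metricMeasurableType d R).
Variable mu : {measure set T -> \bar R}.
Hypothesis mu_doubling : doubling_space mu.
Hypothesis mu_infinite : mu [set: T] = +oo.
Variable alpha : R.
Hypotheses (alpha0 : (0 < alpha)%R) (alpha1 : (alpha <= 1)%R).

Lemma measurable_increment (f : T -> R) (x : T) : measurable_fun [set: T] f ->
  measurable_fun [set: T] (fun y => `|f x - f y| `^ alpha)%R.
Proof.
move=> mf; apply: measurable_fun_powR; apply: measurableT_comp => //.
exact: measurable_funB.
Qed.

Lemma gradient_ge0 (r : R) (f : T -> R) (x : T) : (0 <= gradient mu alpha r f x)%R.
Proof. exact: powR_ge0. Qed.

Lemma gradient_powR (r : R) (f : T -> R) (x : T) :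
  (gradient mu alpha r f x `^ alpha =
   (fine (mu (ball x r)))^-1 * \int[mu]_(y in ball x r) (`|f x - f y| `^ alpha))%R.
Proof.
rewrite /gradient powRVK// mulr_ge0 ?invr_ge0 ?fine_ge0//.
by apply: integral_ge0 => y _; rewrite lee_fin powR_ge0.
Qed.

Lemma increment_integral_lty (f : T -> R) (x : T) (r : R) : sum_space mu alpha f ->
  \int[mu]_(y in ball x r) (`|f x - f y| `^ alpha)%:E < +oo.
Proof.
move=> [h fh [fin1 fin2]]; have mf := measurable_sum_decomposition fh.
have [I [M [[I0 M0] IE _ _ dom]]] :=
  sum_decomposition_domination mu_infinite alpha0 alpha1 fh fin1 fin2.
have mb := measurable_metric_ball mu_doubling x r.
pose c := (`|f x| `^ alpha + M `^ alpha)%R.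
have mw : measurable_fun [set: T] (fun y => (`|h.1 y| `^ alpha)%:E).
  apply/measurable_EFinP; apply: measurable_fun_powR; apply: measurableT_comp => //.
  by case: fh.
apply: (@le_lt_trans _ _ (\int[mu]_(y in ball x r) ((`|h.1 y| `^ alpha)%:E + cst c%:E y))).
  apply: ae_ge0_le_integral => //.
  - apply/measurable_EFinP; apply: measurable_funTS; exact: measurable_increment.
  - by move=> y _; rewrite lee_fin addr_ge0 ?addr_ge0 ?powR_ge0.
  - by apply: emeasurable_funD => //; exact: measurable_funTS.
  apply: filterS dom => y dy _; rewrite lee_fin /c.
  apply: (@le_trans _ _ (`|f x| `^ alpha + `|f y| `^ alpha)%R); last first.
    by rewrite addrCA lerD2l -[leLHS]ger0_norm// powR_ge0.
  apply: le_trans (powR_subadditive alpha0 alpha1 _ _) => //.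
  by apply: le_powR => //; [exact: ltW|exact: ler_normB].
rewrite ge0_integralD//; last 2 first.
- exact: measurable_funTS.
- by move=> y _; rewrite lee_fin addr_ge0 ?powR_ge0.
rewrite integral_cst//; apply: lte_add_pinfty.
  apply: (@le_lt_trans _ _ I%:E); last by rewrite ltry.
  by rewrite -IE; apply: ge0_subset_integral.
by rewrite -[mu _]fineK ?(ball_measure_fin mu_doubling)// -EFinM ltry.
Qed.

(** In measure, at least half of the ball consists of points where |f|^alpha is
    at most its rearrangement at t, and each contributes at least the excess at x. *)
Lemma excess_le_gradient (f : T -> R) (t r : R) (x : T) :
  sum_space mu alpha f -> (0 < t)%R -> (2 * t)%:E <= mu (ball x r) ->
  (`|f x| `^ alpha - rearrangement_fine mu (fun y => `|f y| `^ alpha) t <=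
   2 * gradient mu alpha r f x `^ alpha)%R.
Proof.
move=> ff t0; have Ifin := increment_integral_lty x r ff.
have [h fh [fin1 fin2]] := ff; have mf := measurable_sum_decomposition fh.
set g := fun y : T => (`|f y| `^ alpha)%R.
have mg : measurable_fun [set: T] g by exact: (measurable_abs_powR _ fh).
have g_lty := sum_decomposition_rearrangement_lty mu_infinite alpha0 alpha1 fh fin1 fin2.
set lam := rearrangement_fine mu g t.
have lam0 : (0 <= lam)%R by exact: rearrangement_fine_ge0.
have [gl _|gl tB] := leP (g x - lam)%R 0%R.
  by rewrite (le_trans gl)// mulr_ge0// powR_ge0.
have mb := measurable_metric_ball mu_doubling x r.
have mS : measurable [set y | (g y <= lam)%R] by exact: measurable_set_ler.
have mSb : measurable (ball x r `&` [set y | (g y <= lam)%R]) by exact: measurableI.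
have big_lam : mu [set y | (lam < g y)%R] <= t%:E.
  rewrite (_ : [set y | _] = [set y | (lam < `|g y|)%R]); last first.
    by apply/seteqP; split => y /=; rewrite ger0_norm ?powR_ge0.
  rewrite -/(distribution_fun mu g lam) leNgt -rearrangement_gtP//.
  by rewrite -rearrangement_fineE// ltxx.
set m := fine (mu (ball x r)).
have mE : mu (ball x r) = m%:E by rewrite fineK// (ball_measure_fin mu_doubling).
have tm : (2 * t <= m)%R by rewrite -lee_fin -mE.
have half : (m / 2)%:E <= mu (ball x r `&` [set y | (g y <= lam)%R]).
  have : mu (ball x r) <=
      mu (ball x r `&` [set y | (g y <= lam)%R]) + mu [set y | (lam < g y)%R].
    apply: (@le_trans _ _ (mu ((ball x r `&` [set y | (g y <= lam)%R]) `|`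
        [set y | (lam < g y)%R]))); last first.
      by apply: measureU2 => //; exact: measurable_set_ltr.
    apply: le_mu => //; first by apply: measurableU => //; exact: measurable_set_ltr.
    by move=> y yb; case: (leP (g y) lam) => gy; [left|right].
  rewrite mE => /le_trans/(_ (leeD (lexx _) big_lam)).
  rewrite -leeBlDr// -EFinB => /(le_trans _); apply; rewrite lee_fin.
  by move: tm; rewrite /m; lra.
have key : ((g x - lam) * (m / 2))%:E <= \int[mu]_(y in ball x r) (`|f x - f y| `^ alpha)%:E.
  apply: (@le_trans _ _ (\int[mu]_(y in ball x r `&` [set y | (g y <= lam)%R])
      (cst (g x - lam)%:E y))).
    rewrite integral_cst// EFinM; apply: lee_wpmul2l => //.
    by rewrite lee_fin ltW.
  rewrite integral_mkcond [leRHS]integral_mkcond.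
  apply: le_integral_ge0 => y _; rewrite !patchE.
    by case: ifP => // _; rewrite lee_fin ltW.
  case: ifPn => [/set_mem [yb /= gy]|_].
    rewrite mem_set// lee_fin; apply: le_trans (powR_dist _ _ alpha0 alpha1).
    by rewrite lerD2l lerN2.
  by case: ifP => // _; rewrite lee_fin powR_ge0.
have m0 : (0 < m)%R by apply: lt_le_trans tm; rewrite mulr_gt0.
rewrite gradient_powR -/m mulrCA -ler_pdivrMl ?invr_gt0// invrK.
have : ((g x - lam) * (m / 2) <=
    \int[mu]_(y in ball x r) (`|f x - f y| `^ alpha))%R.
  rewrite -lee_fin /Rintegral fineK ?ge0_fin_numE//.
  by apply: integral_ge0 => y _; rewrite lee_fin powR_ge0.
have double (a e I0 : R) : (a * (e / 2) <= I0 -> e * a <= 2 * I0)%R by lra.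
exact: double.
Qed.

End gradient_bounds.

Section modulus_bound.
Context (d : measure_display) (R : realType) (T : metricMeasurableType d R).
Variable mu : {measure set T -> \bar R}.
Hypothesis mu_doubling : doubling_space mu.
Hypothesis mu_infinite : mu [set: T] = +oo.
Variable Psi : T -> R.
Hypothesis mPsi : measurable_fun [set: T] Psi.
Hypothesis PsiE : forall u : R, (0 <= u)%R -> mu [set x | (Psi x <= u)%R] = u%:E.
Variable X : qri_space mu.
Variables alpha C : R.
Hypotheses (alpha0 : (0 < alpha)%R) (alpha1 : (alpha <= 1)%R) (C0 : (0 < C)%R).
Hypothesis convexC : forall (n : nat) (f : 'I_n -> T -> R),
  (forall j, qri_mem X (f j)) ->
  qri_enorm X (fun x => (\sum_(j < n) `|f j x| `^ alpha) `^ alpha^-1)%R <=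
  (C * (\sum_(j < n) qri_norm X (f j) `^ alpha) `^ alpha^-1)%R%:E.

Lemma besov_modulus_ge0 (f : T -> R) (r : R) : 0 <= besov_modulus alpha X f r.
Proof.
rewrite /besov_modulus /qri_enorm; case: ifPn => [/set_mem Xf|_]; last exact: leey.
by rewrite lee_fin qri_norm_ge0.
Qed.

(** The excess of |f|^alpha over its rearrangement at t is pointwise at most twice
    the alpha-th power of the gradient, whose quasi-norm is the modulus. *)
Lemma oscillation_le_modulus (f : T -> R) (t r : R) : sum_space mu alpha f ->
  (0 < t)%R -> (forall x, (2 * t)%:E <= mu (ball x r)) ->
  oscillation mu (fun x => `|f x| `^ alpha)%R t `^ alpha^-1 *
    (fundamental_fun X t)%:E <=
  (C * 2 `^ alpha^-1)%:E * besov_modulus alpha X f r.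
Proof.
move=> ff t0 tB; have K0 : (0 < C * 2 `^ alpha^-1)%R by rewrite mulr_gt0// powR_gt0.
have [h fh [fin1 fin2]] := ff.
rewrite /besov_modulus /qri_enorm; case: ifPn => [/set_mem XG|_]; last first.
  by rewrite gt0_muley ?lte_fin// leey.
have g_lty := sum_decomposition_rearrangement_lty mu_infinite alpha0 alpha1 fh fin1 fin2.
rewrite -EFinM -mulrA.
apply: (oscillation_average mPsi PsiE alpha0 C0 convexC _ _ g_lty t0 XG) => x.
- exact: (measurable_abs_powR _ fh).
- exact: powR_ge0.
- exact: gradient_ge0.
- exact: excess_le_gradient.
Qed.

End modulus_bound.

(** * Volumes against radii *)

Section dyadic_comparison.
Context (R : realType).
Local Notation leb := (@lebesgue_measure R).

Lemma disjoint_series_le (A : nat -> set R) (c : nat -> \bar R) (x : R) (M : \bar R) :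
  (forall i j, A i x -> A j x -> i = j) -> 0 <= M ->
  (forall i, A i x -> 0 <= c i <= M) ->
  \sum_(0 <= i <oo) (cst (c i) \_ (A i)) x <= M.
Proof.
move=> dA M0 cM; apply: lime_le.
  apply: is_cvg_nneseries => i _ _; rewrite patchE.
  by case: ifPn => // /set_mem /cM /andP[].
apply: nearW => n; rewrite big_mkord.
have [[i Ai]|/forallNP nA] := pselect (exists i : 'I_n, A i x); last first.
  by rewrite big1// => i _; rewrite patchE memNset.
rewrite (bigD1 i)//= big1 ?adde0.
  by rewrite patchE mem_set//; have /andP[] := cM _ Ai.
move=> j ji; rewrite patchE memNset// => /(dA _ _ Ai) ij.
by move: ji; rewrite -(val_inj ij) eqxx.
Qed.

Lemma poweR_add_le (r : R) (x y : \bar R) : (0 < r)%R -> 0 <= x -> 0 <= y ->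
  (x + y) `^ r^-1 <= (2 `^ r^-1)%:E * (x `^ r^-1 + y `^ r^-1).
Proof.
move=> r0; have ri : (r^-1 != 0)%R by rewrite invr_eq0 gt_eqF.
have p2 : (0 < 2 `^ r^-1 :> R)%R by rewrite powR_gt0.
case: x => [x x0|_ y0|//]; last first.
  by rewrite poweRyr// [X in _ * X]addye ?gt0_muley ?lte_fin ?leey// gt_eqF// (lt_le_trans _ (poweR_ge0 _ _)).
case: y => [y y0|_|//]; last first.
  by rewrite addey ?poweRyr// [X in _ * X]addey// ?gt0_muley ?lte_fin ?leey.
by rewrite -EFinD !poweR_EFin -EFinD -EFinM lee_fin; exact: powRV_add_le.
Qed.

Variables (D c0 : R).
Hypotheses (D1 : (1 < D)%R) (c00 : (0 < c0)%R).

Let D0 : (0 < D)%R. Proof. exact: lt_trans D1. Qed.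

Let I k := `](c0 / D ^+ k.+1)%R, (c0 / D ^+ k)%R]%classic.
Let J k : set R := `](2^-1 ^+ k)%R, (2 * 2^-1 ^+ k)%R]%classic.

Let leb_I k : leb (I k) = ((D - 1) * (c0 / D ^+ k.+1))%:E.
Proof.
rewrite lebesgue_measure_itv/= lte_fin ifT.
  rewrite -EFinB exprS invfM; congr (_%:E).
  rewrite [RHS]mulrBl mul1r; congr (_ - _)%R.
  by rewrite [RHS]mulrCA mulVKf ?gt_eqF.
by rewrite ltr_pM2l// ltf_pV2 ?posrE ?exprn_gt0// exprS ltr_pMl// exprn_gt0.
Qed.

Let leb_J k : leb (J k) = (2^-1 ^+ k)%:E.
Proof.
rewrite lebesgue_measure_itv/= lte_fin ifT.
  by rewrite -EFinB mulr_natl mulr2n addrK.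
by rewrite ltr_pMl ?exprn_gt0// ltr1n.
Qed.

Let I_disj i j x : I i x -> I j x -> i = j.
Proof.
wlog ij : i j / (i <= j)%N => [h xi xj|].
  by case: (leqP i j) => [/h|/ltnW /h]; [exact|move=> /(_ xj xi)].
rewrite /I /= !in_itv/= => /andP[ix _] /andP[_ xj].
apply/eqP; rewrite eqn_leq ij/= leqNgt; apply/negP => lt_ij.
have := lt_le_trans ix xj; rewrite ltNge => /negP; apply.
by rewrite ler_pM2l// lef_pV2 ?posrE ?exprn_gt0// ler_weXn2l// ltW.
Qed.

Let J_disj i j x : J i x -> J j x -> i = j.
Proof.
wlog ij : i j / (i <= j)%N => [h xi xj|].
  by case: (leqP i j) => [/h|/ltnW /h]; [exact|move=> /(_ xj xi)].
rewrite /J /= !in_itv/= => /andP[ix _] /andP[_ xj].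
apply/eqP; rewrite eqn_leq ij/= leqNgt; apply/negP => lt_ij.
have := lt_le_trans ix xj; rewrite ltNge => /negP; apply.
case: j lt_ij {ij xj} => // j ij; rewrite exprS mulrA divff// mul1r.
by apply: ler_wiXn2l => //; rewrite ?invr_ge0// invf_le1// ler1n.
Qed.

Lemma in_some_geometric_interval (t : R) : (0 < t)%R -> (t <= c0)%R -> exists k, I k t.
Proof.
move=> t0 tc.
have ex : exists k, (c0 / D ^+ k.+1 < t)%R.
  have [k hk] : exists k, (c0 / t < D ^+ k)%R.
    have D10 : (0 < D - 1)%R by rewrite subr_gt0.
    exists (Num.trunc (c0 / t / (D - 1))).+1.
    have bernoulli n : (1 + n%:R * (D - 1) <= D ^+ n)%R.
      elim: n => [|n IH]; first by rewrite mul0r addr0 expr0.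
      rewrite exprS.
      have : ((D - 1) <= (D - 1) * D ^+ n)%R by rewrite ler_peMr ?(ltW D10)// exprn_ege1// ltW.
      by move: IH; rewrite -(natr1 n); move: (D ^+ n)%R (n%:R)%R => E m; lra.
    apply: lt_le_trans (bernoulli _).
    by rewrite ltr_wpDl// -ltr_pdivrMr// truncnS_gt.
  exists k; rewrite ltr_pdivrMr ?exprn_gt0// mulrC -ltr_pdivrMr//.
  by apply: lt_trans hk _; rewrite exprS ltr_pMl// exprn_gt0.
case: (ex_minnP ex) => k kt kmin; exists k; rewrite /I /= in_itv/= kt/=.
case: k kmin {kt} => [_|k kmin]; first by rewrite expr0 divr1.
by rewrite leNgt; apply/negP => /kmin; rewrite ltnn.
Qed.

(** Each I k has the same mass for dt/t, up to a constant, as each J k for dr/r.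
    With U k the supremum of G on I k, both integrals are therefore compared with
    the sum of the (U k)^q: the one of G from above, the one of H from below.
    Passing through U k allows arbitrary nonnegative G and H. *)
Let near_far_real (q : R) (G H : R -> \bar R) (K : R) (W : \bar R) : (0 < q)%R ->
  (forall t, 0 <= G t) -> (forall r, 0 <= H r) -> (0 < K)%R -> 0 <= W ->
  (forall k t r, I k t -> J k r -> G t <= K%:E * H r) ->
  (forall t, (c0 < t)%R -> (t < 1)%R -> G t <= W) ->
  \int[leb]_(t in `]0%R, 1%R[) (G t `^ q * (t^-1)%:E) <=
  (2 * (D - 1) * K `^ q)%:E *
    \int[leb]_(r in `]0%R, +oo[) (H r `^ q * (r^-1)%:E) +
  (c0^-1)%:E * W `^ q.
Proof.
move=> q0 G0 H0 K0 W0 near far.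
have D10 : (0 < D - 1)%R by rewrite subr_gt0.
have q0' : (0 <= q)%R by exact: ltW.
have pow_le (x y : \bar R) : 0 <= x -> x <= y -> x `^ q <= y `^ q.
  move=> x0 xy; apply: gt0_ler_poweR => //; rewrite in_itv/= leey ?x0//.
  by rewrite (le_trans x0).
have Dk0 k : (0 < D ^+ k)%R by rewrite exprn_gt0.
have Jk0 k : (0 < 2^-1 ^+ k :> R)%R by rewrite exprn_gt0.
pose U k := ereal_sup [set G t | t in I k].
have U_ge k t : I k t -> G t <= U k.
  by move=> It; apply: ereal_sup_ubound; exists t.
have U0 k : 0 <= U k.
  have Ik : I k (c0 / D ^+ k)%R.
    rewrite /I /= in_itv/= lexx andbT ltr_pM2l// ltf_pV2 ?posrE//.
    by rewrite exprS ltr_pMl.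
  exact: le_trans (G0 _) (U_ge _ _ Ik).
have U_le k r : J k r -> U k <= K%:E * H r.
  by move=> Jr; apply: ge_ereal_sup => _ [t It <-]; exact: near It Jr.
pose Uq k := U k `^ q.
have Uq0 k : 0 <= Uq k by exact: poweR_ge0.
pose u k := cst (Uq k * ((c0 / D ^+ k.+1)^-1)%:E) \_ (I k).
pose v k := cst ((K^-1 `^ q)%:E * Uq k * ((2 * 2^-1 ^+ k)^-1)%:E) \_ (J k).
have u0 k t : 0 <= u k t.
  rewrite /u patchE; case: ifP => // _; rewrite mule_ge0// lee_fin invr_ge0.
  by rewrite divr_ge0// ltW.
have v0 k r : 0 <= v k r.
  rewrite /v patchE; case: ifP => // _; apply: mule_ge0; last first.
    by rewrite lee_fin invr_ge0 mulr_ge0// ltW.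
  by apply: mule_ge0; rewrite ?lee_fin ?powR_ge0//; exact: Uq0.
have mu_ k (A : set R) : measurable_fun A (u k).
  apply: measurable_funTS; apply/(measurable_restrictT _ _).1 => //.
  exact: measurable_itv.
have mv_ k (A : set R) : measurable_fun A (v k).
  apply: measurable_funTS; apply/(measurable_restrictT _ _).1 => //.
  exact: measurable_itv.
have step1 : \int[leb]_(t in `]0%R, 1%R[) (G t `^ q * (t^-1)%:E) <=
    \int[leb]_(t in `]0%R, 1%R[)
      (\sum_(0 <= k <oo) u k t + cst ((c0^-1)%:E * W `^ q) t).
  apply: le_integral_ge0 => t; rewrite /= in_itv/= => /andP[t0 t1].
    by rewrite mule_ge0 ?poweR_ge0// lee_fin invr_ge0 ltW.
  have S0 : 0 <= \sum_(0 <= k <oo) u k t by exact: nneseries_ge0.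
  have W'0 : 0 <= (c0^-1)%:E * W `^ q.
    by rewrite mule_ge0 ?poweR_ge0// lee_fin invr_ge0 ltW.
  have [tc|ct] := leP t c0.
    have [k kt] := in_some_geometric_interval t0 tc.
    apply: (@le_trans _ _ (u k t)).
      rewrite /u patchE mem_set//; apply: lee_pmul; rewrite ?poweR_ge0//.
      - by rewrite lee_fin invr_ge0 ltW.
      - by apply: pow_le => //; exact: U_ge.
      - move: kt; rewrite /I /= in_itv/= => /andP[kt _].
        by rewrite lee_fin lef_pV2 ?posrE ?divr_gt0// ltW.
    rewrite -[leLHS]adde0; apply: leeD => //.
    apply: le_trans (nneseries_lim_ge k.+1 _) => //.
    by rewrite big_nat_recr//= leeDr// sume_ge0.
  rewrite -[leLHS]add0e; apply: leeD => //; rewrite muleC; apply: lee_pmul.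
  - by rewrite lee_fin invr_ge0 ltW.
  - exact: poweR_ge0.
  - by rewrite lee_fin lef_pV2 ?posrE// ltW.
  - by apply: pow_le => //; exact: far.
have int_patch (A B : set R) (c : \bar R) : measurable A -> measurable B -> 0 <= c ->
    \int[leb]_(t in B) (cst c \_ A) t <= c * leb A.
  move=> mA mB c0'; rewrite -integral_cst// [leRHS]integral_mkcond.
  apply: ge0_subset_integral => //.
    by apply/(measurable_restrictT _ _).1 => //; exact: measurable_cst.
  by move=> x _; rewrite patchE; case: ifP.
have step2 : \int[leb]_(t in `]0%R, 1%R[)
      (\sum_(0 <= k <oo) u k t + cst ((c0^-1)%:E * W `^ q) t) <=
    (D - 1)%:E * \sum_(0 <= k <oo) Uq k + (c0^-1)%:E * W `^ q.
  rewrite ge0_integralD//=; last 3 first.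
  - by move=> t _; exact: nneseries_ge0.
  - by apply: (@ge0_emeasurable_sum _ _ _ _ _ xpredT) => [k x _ _|k _]; [exact: u0|exact: mu_].
  - by move=> t _; rewrite mule_ge0 ?poweR_ge0// lee_fin invr_ge0 ltW.
  rewrite integral_cst//= lebesgue_measure_itv/= lte_fin ltr01 sube0 mule1.
  apply: leeD => //.
  rewrite integral_nneseries//; last by move=> k; exact: mu_.
  rewrite -nneseriesZl//.
  apply: lee_nneseries => [k _ _|k _]; first exact: integral_ge0.
  apply: (le_trans (int_patch _ _ _ _ _ _)) => //.
  - exact: measurable_itv.
  - by rewrite mule_ge0// lee_fin invr_ge0 divr_ge0// ltW.
  rewrite leb_I -muleA -EFinM muleC; apply: lee_wpmul2r => //.
  by rewrite lee_fin mulrCA mulVf ?mulr1// gt_eqF// divr_gt0.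
have step3 : ((K^-1 `^ q) * 2^-1)%:E * \sum_(0 <= k <oo) Uq k <=
    \int[leb]_(r in `]0%R, +oo[) (H r `^ q * (r^-1)%:E).
  rewrite -nneseriesZl//.
  apply: (@le_trans _ _ (\int[leb]_(r in `]0%R, +oo[) (\sum_(0 <= k <oo) v k r))); last first.
    apply: le_integral_ge0 => r; rewrite /= in_itv/= andbT => r0.
      exact: nneseries_ge0.
    apply: disjoint_series_le => [i j||k kr]; first exact: J_disj.
      by rewrite mule_ge0 ?poweR_ge0// lee_fin invr_ge0 ltW.
    have rJ : (r <= 2 * 2^-1 ^+ k)%R by move: kr; rewrite /J /= in_itv/= => /andP[].
    have J20 : 0 <= ((2 * 2^-1 ^+ k)^-1 : R)%:E.
      by rewrite lee_fin invr_ge0 mulr_ge0// ltW.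
    have KU0 : 0 <= (K^-1 `^ q)%:E * Uq k by rewrite mule_ge0// lee_fin powR_ge0.
    apply/andP; split; first by rewrite mule_ge0.
    apply: lee_pmul => //; last by rewrite lee_fin lef_pV2 ?posrE ?mulr_gt0.
    rewrite -poweR_EFin -poweRM ?lee_fin ?invr_ge0 ?(ltW K0)//; apply: pow_le.
      by rewrite mule_ge0// lee_fin invr_ge0 ltW.
    by rewrite lee_pdivrMl//; exact: U_le.
  rewrite integral_nneseries//; last by move=> k; exact: mv_.
  apply: lee_nneseries => [k _ _|k _].
    by rewrite mule_ge0// lee_fin mulr_ge0 ?powR_ge0.
  rewrite /v -integral_mkcondr setIidr; last first.
    move=> r; rewrite /J /= !in_itv/= andbT => /andP[+ _].
    exact: lt_trans.
  set c := _ * _ * _; have -> : \int[leb]_(r in J k) cst c r = c * leb (J k).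
    by rewrite integral_cst//; exact: measurable_itv.
  rewrite leb_J /c -muleA -EFinM -muleA muleCA muleC.
  apply: lee_wpmul2l => //; rewrite -EFinM lee_fin ler_wpM2l ?powR_ge0//.
  by rewrite invfM -mulrA mulVf ?mulr1 ?gt_eqF.
apply: le_trans step1 _; apply: le_trans step2 _.
apply: leeD => //; rewrite (mulrC 2%R) -mulrA EFinM -muleA; apply: lee_wpmul2l.
  by rewrite lee_fin ltW.
rewrite -lee_pdivrMl ?mulr_gt0 ?powR_gt0//; apply: le_trans step3.
by rewrite invfM [X in X%:E * _ <= _]mulrC powR_inv ?(ltW K0).
Qed.

(** The k-th D-adic interval below c0 corresponds to the k-th dyadic interval
    below 2, as volumes correspond to radii; the constant A depends neither on the
    functions nor on K and W. *)
Lemma Lq_dyadic_comparison (q : \bar R) : 0 < q ->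
  exists2 A : R, (0 < A)%R & forall (G H : R -> \bar R) (K : R) (W : \bar R),
  (forall t, 0 <= G t) -> (forall r, 0 <= H r) -> (0 < K)%R -> 0 <= W ->
  (forall (k : nat) t r, (c0 / D ^+ k.+1 < t <= c0 / D ^+ k)%R ->
    (2^-1 ^+ k < r <= 2 * 2^-1 ^+ k)%R -> G t <= K%:E * H r) ->
  (forall t, (c0 < t)%R -> (t < 1)%R -> G t <= W) ->
  Lq_dt_over_t q `]0%R, 1%R[ G <= A%:E * (K%:E * Lq_dt_over_t q `]0%R, +oo[ H + W).
Proof.
case: q => [q q0|_|//]; last first.
  exists 1%R => // G H K W G0 H0 K0 W0 near far; rewrite mul1e.
  apply: ge_ereal_sup => _ [t + <-]; rewrite /= in_itv/= => /andP[t0 t1].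
  have supH r : (0 < r)%R -> H r <= ereal_sup [set H t | t in `]0%R, +oo[].
    by move=> r0; apply: ereal_sup_ubound; exists r => //=; rewrite in_itv/= andbT.
  have [tc|ct] := leP t c0.
    have [k kt] := in_some_geometric_interval t0 tc.
    have J0 : (0 < 2^-1 ^+ k :> R)%R by rewrite exprn_gt0.
    rewrite -[leLHS]adde0; apply: leeD => //.
    apply: le_trans (near k t (2 * 2^-1 ^+ k)%R _ _) _.
    - by move: kt; rewrite /I /= in_itv.
    - by rewrite lexx andbT ltr_pMl// ltr1n.
    by apply: lee_wpmul2l; rewrite ?lee_fin ?(ltW K0)// supH// mulr_gt0.
  rewrite -[leLHS]add0e; apply: leeD; last exact: far.
  rewrite mule_ge0// ?lee_fin ?(ltW K0)//.
  by apply: le_trans (H0 1%R) (supH _ _).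
rewrite lte_fin in q0; have qi0 : (0 <= q^-1)%R by rewrite invr_ge0 ltW.
have D10 : (0 < D - 1)%R by rewrite subr_gt0.
exists (2 `^ q^-1 * ((2 * (D - 1)) `^ q^-1 + c0^-1 `^ q^-1))%R.
  by rewrite mulr_gt0 ?powR_gt0// addr_gt0// powR_gt0 ?mulr_gt0// invr_gt0.
move=> G H K W G0 H0 K0 W0 near far; rewrite /Lq_dt_over_t.
set IH := \int[leb]_(r in `]0%R, +oo[) (H r `^ q * (r^-1)%:E).
have IH0 : 0 <= IH.
  apply: integral_ge0 => r; rewrite /= in_itv/= andbT => r0.
  by rewrite mule_ge0 ?poweR_ge0// lee_fin invr_ge0 ltW.
have := @near_far_real q G H K W q0 G0 H0 K0 W0 _ far; rewrite -/IH => bound.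
apply: (@le_trans _ _ (((2 * (D - 1) * K `^ q)%:E * IH + (c0^-1)%:E * W `^ q) `^ q^-1)).
  apply: gt0_ler_poweR => //; rewrite ?in_itv/= ?leey ?andbT.
  - apply: integral_ge0 => t; rewrite /= in_itv/= => /andP[t0 _].
    by rewrite mule_ge0 ?poweR_ge0// lee_fin invr_ge0 ltW.
  - rewrite adde_ge0 ?mule_ge0 ?poweR_ge0// lee_fin ?invr_ge0 ?(ltW c00)//.
    by rewrite !mulr_ge0 ?powR_ge0// ltW.
  by apply: bound => k t r It Jr; apply: (near k); move: It Jr; rewrite /I /J /= !in_itv.
apply: le_trans (poweR_add_le q0 _ _) _.
- by rewrite mule_ge0// lee_fin !mulr_ge0 ?powR_ge0// ltW.
- by rewrite mule_ge0 ?poweR_ge0// lee_fin invr_ge0 ltW.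
rewrite [X in _ <= X * _]EFinM -[leRHS]muleA.
apply: lee_wpmul2l; first by rewrite lee_fin powR_ge0.
rewrite !poweRM ?poweR_ge0 ?lee_fin ?invr_ge0 ?(ltW c00) ?mulr_ge0 ?powR_ge0 ?(ltW D10)//.
rewrite !poweR_EFin powRM ?mulr_ge0 ?powR_ge0 ?(ltW D10)// powRK ?(ltW K0)//.
rewrite -poweRrM mulfV ?gt_eqF// poweRe1// EFinM -muleA.
rewrite EFinD ge0_muleDl ?lee_fin ?powR_ge0//.
rewrite ge0_muleDr ?mule_ge0 ?poweR_ge0 ?lee_fin ?(ltW K0)//.
apply: leeD.
  by rewrite leeDl// mule_ge0 ?lee_fin ?powR_ge0.
apply: lee_wpmul2l; first by rewrite lee_fin powR_ge0.
by rewrite leeDr// mule_ge0 ?lee_fin ?(ltW K0) ?poweR_ge0.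
Qed.

End dyadic_comparison.

(** * Non-collapsing implies the estimate *)

Section noncollapsing_implies_estimate.
Context (d : measure_display) (R : realType) (T : metricMeasurableType d R).
Variable mu : {measure set T -> \bar R}.
Hypothesis mu_doubling : doubling_space mu.
Hypothesis mu_infinite : mu [set: T] = +oo.

Let D := doubling_constant mu.
Let Q := upper_dimension mu.

Let D1 : (1 < D)%R. Proof. by have [] := doubling_constantP mu_doubling mu_infinite. Qed.
Let D0 : (0 < D)%R. Proof. exact: lt_trans D1. Qed.
Let Q0 : (0 < Q)%R. Proof. exact: upper_dimension_gt0. Qed.

Lemma ball_measure_ge (b : R) (x : T) (r : R) (k : nat) :
  b%:E <= mu (ball x 1%R) -> (2^-1 ^+ k <= r)%R -> (b / D ^+ k)%:E <= mu (ball x r).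
Proof.
move=> bx kr; have k0 : (0 < 2^-1 ^+ k :> R)%R by rewrite exprn_gt0.
apply: (@le_trans _ _ (mu (ball x (2^-1 ^+ k)%R))); last first.
  apply: le_mu; [exact: (measurable_metric_ball mu_doubling)..|].
  by apply: ball_subset; rewrite mdistxx add0r.
have := ball_doubling_iter mu_doubling mu_infinite x k k0.
rewrite -exprMn mulfV// expr1n => /(le_trans bx).
by rewrite mulrC EFinM lee_pdivrMl// exprn_gt0.
Qed.

Lemma expr2_doubling (n : nat) : ((D ^+ n) `^ Q^-1 = 2 ^+ n)%R.
Proof.
rewrite /D -(powR2_upper_dimension mu_doubling mu_infinite) -/Q.
rewrite -powR_mulrn ?powR_ge0// -powRrM mulrC powRrM powR_mulrn//.
by rewrite powRK// exprn_ge0.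
Qed.

(** The radius r and the volume t are comparable through r^Q ~ t. *)
Lemma powR_scale_comparison (c t r s : R) (k : nat) :
  (0 < c)%R -> (c <= 1)%R -> (0 < s)%R -> (s < 1)%R ->
  (c / D ^+ k.+1 < t)%R -> (0 < r)%R -> (r <= 2 * 2^-1 ^+ k)%R ->
  ((t `^ (s / Q))^-1 <= 4 * c^-1 `^ Q^-1 * r `^ (- s))%R.
Proof.
move=> c0 c1 s0 s1 kt r0 rk; set K := (4 * _)%R.
have t0 : (0 < t)%R by apply: lt_trans kt; rewrite divr_gt0// exprn_gt0.
have Qi0 : (0 <= Q^-1)%R by rewrite invr_ge0 ltW.
have K1 : (1 <= K)%R.
  rewrite /K -[leLHS]mul1r ler_pM//; first by rewrite ler1n.
  have -> : (1 = 1 `^ Q^-1 :> R)%R by rewrite powR1.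
  by apply: le_powR => //; rewrite invf_ge1.
have K0 : (0 <= K)%R by exact: le_trans K1.
have rK : (r <= K * t `^ Q^-1)%R.
  rewrite /K -mulrA -powRM ?invr_ge0 ?(ltW c0) ?(ltW t0)//.
  apply: (le_trans rk).
  have -> : (2 * 2^-1 ^+ k = 4 * 2^-1 ^+ k.+1 :> R)%R.
    by rewrite exprS mulrA; congr (_ * _)%R; field.
  rewrite ler_pM2l// exprVn -expr2_doubling -powR_inv ?exprn_ge0 ?(ltW D0)//.
  apply: le_powR => //; first by rewrite invr_ge0 exprn_ge0// ltW.
  by rewrite ler_pdivlMl// ltW.
have : (r `^ s <= K * t `^ (s / Q))%R.
  apply: (@le_trans _ _ ((K * t `^ Q^-1) `^ s)%R).
    by apply: le_powR => //; exact: ltW.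
  rewrite powRM ?powR_ge0// -powRrM [(Q^-1 * s)%R]mulrC ler_wpM2r ?powR_ge0//.
  by apply: ler1_powR => //; exact: ltW.
by rewrite powRN ler_pdivlMr ?powR_gt0// ler_pdivrMl ?powR_gt0// mulrC.
Qed.

Hypothesis mu_point : forall x : T, mu [set x] = 0.
Variables (alpha : R) (X : qri_space mu).
Hypotheses (alpha0 : (0 < alpha)%R) (alpha1 : (alpha <= 1)%R).
Hypothesis X_convex : alpha_convex X alpha.

Lemma fundamental_fun_nonneg (t : R) : (0 <= fundamental_fun X t)%R.
Proof.
rewrite /fundamental_fun; apply: qri_norm_ge0; apply: qri_indic.
  by case: xgetP => [E -> []|_].
by case: xgetP => [E -> [_ ->]|_]; rewrite ?ltry// measure0.
Qed.

(** For c = min(b/2, 1) the balls of radius 2^-k have measure at least 2 c D^-k,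
    so the modulus at radius r in ]2^-k, 2^(1-k)] controls the oscillation at t in
    ]c D^-(k+1), c D^-k]. Between c and 1 the norm of the sum space suffices. *)
Lemma noncollapsing_estimate : non_collapsing mu ->
  forall q : \bar R, 0 < q -> exists2 C : R, (0 < C)%R &
  forall s : R, (0 < s)%R -> (s < 1)%R ->
  forall f : T -> R, sum_space mu alpha f ->
     Lq_dt_over_t q `]0%R, 1%R[
       (fun t => oscillation mu (fun x => `|f x| `^ alpha)%R t `^ alpha^-1 *
                 (fundamental_fun X t / t `^ (s / upper_dimension mu))%R%:E)
     <= C%:E * (besov_seminorm alpha X s q f + sum_norm mu alpha f).
Proof.
move=> [b b0 infb] q q0; have [C C0 convexC] := X_convex.
have [Psi mPsi PsiE] := exists_uniform_map mu_doubling mu_infinite mu_point.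
have bx x : b%:E <= mu (ball x 1%R).
  by rewrite -infb; apply: ereal_inf_lbound; exists x.
pose c : R := Num.min (b / 2)%R 1%R.
have c0 : (0 < c)%R by rewrite lt_min divr_gt0//=.
have c1 : (c <= 1)%R by rewrite ge_min lexx orbT.
have cb : (2 * c <= b)%R by rewrite mulrC -ler_pdivlMr// ge_min lexx.
have [A A0 cmp] := Lq_dyadic_comparison D1 c0 q0.
pose K1 := (C * 2 `^ alpha^-1 * (4 * c^-1 `^ Q^-1))%R.
pose K2 := (2 `^ alpha^-1 * c^-1 `^ alpha^-1 * (fundamental_fun X 1 * c^-1 `^ Q^-1))%R.
have K10 : (0 < K1)%R by rewrite !mulr_gt0// powR_gt0// invr_gt0.
have K20 : (0 <= K2)%R by rewrite !mulr_ge0 ?powR_ge0// fundamental_fun_nonneg.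
exists (A * (K1 + K2))%R; first by rewrite mulr_gt0// ltr_wpDr.
move=> s s0 s1 f ff; set S := sum_norm mu alpha f.
have S0 : 0 <= S by exact: sum_norm_ge0.
have B0 : 0 <= besov_seminorm alpha X s q f.
  rewrite /besov_seminorm /Lq_dt_over_t; case: q q0 {cmp} => [q q0|_|//].
    exact: poweR_ge0.
  apply: (@le_trans _ _ ((1 `^ (- s))%:E * besov_modulus alpha X f 1)).
    by rewrite mule_ge0 ?besov_modulus_ge0// lee_fin powR_ge0.
  by apply: ereal_sup_ubound; exists 1%R => //=; rewrite in_itv/= ltr01.
have [h fh [fin1 fin2]] := ff.
have g_lty := sum_decomposition_rearrangement_lty mu_infinite alpha0 alpha1 fh fin1 fin2.
apply: (@le_trans _ _ (A%:E * (K1%:E * besov_seminorm alpha X s q f + K2%:E * S))); last first.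
  rewrite (EFinM A) -[leRHS]muleA; apply: lee_wpmul2l; first by rewrite lee_fin ltW.
  rewrite EFinD ge0_muleDl ?lee_fin ?(ltW K10)//.
  apply: leeD; apply: lee_wpmul2l; rewrite ?lee_fin ?(ltW K10)//.
    by rewrite leeDl.
  by rewrite leeDr.
apply: cmp => // [t|r|||t ct t1].
- by rewrite mule_ge0 ?poweR_ge0// lee_fin divr_ge0 ?powR_ge0// fundamental_fun_nonneg.
- by rewrite mule_ge0 ?besov_modulus_ge0// lee_fin powR_ge0.
- by rewrite mule_ge0.
- move=> k t r /andP[kt tk] /andP[kr rk].
  have t0 : (0 < t)%R by apply: lt_trans kt; rewrite divr_gt0// exprn_gt0.
  have r0 : (0 < r)%R by rewrite (le_lt_trans _ kr)// exprn_ge0.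
  have tB x : (2 * t)%:E <= mu (ball x r).
    apply: le_trans (ball_measure_ge (bx x) (ltW kr)); rewrite lee_fin.
    rewrite ler_pdivlMr ?exprn_gt0// -mulrA; apply: le_trans cb.
    by rewrite ler_pM2l// -ler_pdivlMr ?exprn_gt0.
  have := oscillation_le_modulus mu_doubling mu_infinite mPsi PsiE alpha0 alpha1 C0 convexC ff t0 tB.
  set O := oscillation _ _ _ `^ _ => Ole.
  rewrite [X in O * X]EFinM muleA /K1 (EFinM (C * _)) [X in _ <= _ * X]muleC muleACA.
  apply: lee_pmul => //.
  + by rewrite mule_ge0 ?poweR_ge0// lee_fin fundamental_fun_nonneg.
  + by rewrite lee_fin invr_ge0 powR_ge0.
  + by rewrite -EFinM lee_fin; exact: (powR_scale_comparison c0 c1 s0 s1 kt r0 rk).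
- have t0 : (0 < t)%R by exact: lt_trans ct.
  have Ole := oscillation_le_sum_norm mu_infinite alpha0 alpha1 f t0 (ltW t1).
  have a10 : (0 <= alpha^-1)%R by rewrite invr_ge0 ltW.
  have ti : (t^-1 <= c^-1)%R by rewrite lef_pV2 ?posrE// ltW.
  rewrite /K2 (EFinM (2 `^ alpha^-1 * _)) muleAC.
  apply: lee_pmul; rewrite ?poweR_ge0//.
  + by rewrite lee_fin divr_ge0 ?powR_ge0// fundamental_fun_nonneg.
  + apply: (le_trans Ole); apply: lee_wpmul2r => //; rewrite lee_fin.
    by rewrite ler_pM2l ?powR_gt0//; apply: le_powR => //; rewrite invr_ge0 ltW.
  + rewrite lee_fin; apply: ler_pM; rewrite ?invr_ge0 ?powR_ge0 ?fundamental_fun_nonneg//.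
      by apply: (fundamental_fun_nd mPsi PsiE); exact: ltW.
    have ci1 : (1 <= c^-1)%R by rewrite invf_ge1.
    have Qi0 : (0 <= Q^-1)%R by rewrite invr_ge0 ltW.
    apply: (@le_trans _ _ (c^-1 `^ (s / Q))%R).
      rewrite -powR_inv ?(ltW t0)//; apply: le_powR => //; last by rewrite invr_ge0 ltW.
      by rewrite mulr_ge0// ltW.
    by apply: ler_powR => //; rewrite ler_piMl// ltW.
Qed.

End noncollapsing_implies_estimate.

(** * Measurability of the gradient *)

Section gradient_measurability.
Context (d : measure_display) (R : realType) (T : metricMeasurableType d R).
Variable mu : {measure set T -> \bar R}.
Hypothesis mu_doubling : doubling_space mu.
Hypothesis mu_infinite : mu [set: T] = +oo.

Lemma sigma_finite_doubling : sigma_finite [set: T] mu.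
Proof.
exists (fun n => ball (point : T) (n%:R : R)).
  apply/seteqP; split => // x _; exists (Num.trunc (mdist (point : T) x)).+1 => //.
  by rewrite in_ball; exact: truncnS_gt.
move=> n; split; first exact: (measurable_metric_ball mu_doubling).
by have := ball_measure_fin mu_doubling point n%:R; rewrite ge0_fin_numE.
Qed.

(* An alias of mu that can carry the sigma-finite structure, for Fubini. *)
Let nu : set T -> \bar R := mu.
HB.instance Definition _ := Measure.on nu.
HB.instance Definition _ := Measure_isSigmaFinite.Build _ _ _ nu sigma_finite_doubling.

(** By separability the relation d(x, y) < r is a countable union of products
    of balls. *)
Lemma measurable_ball_relation (r : R) :
  measurable [set p : T * T | ball p.1 r p.2].
Proof.
have [z hz] := exists_dense_sequence mu_doubling mu_infinite.
pose e (j : nat) : R := j.+1%:R^-1%R.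
have e0 j : (0 < e j)%R by rewrite invr_gt0.
rewrite (_ : [set p | _] = \bigcup_k \bigcup_j
    (ball (z k) (e j) `*` ball (z k) (r - e j)%R)).
  apply: bigcup_measurable => k _; apply: bigcup_measurable => j _.
  by apply: measurableX; exact: (measurable_metric_ball mu_doubling).
apply/seteqP; split => [[x y]/=|[x y] [k _] [j _] [/=]]; rewrite !in_ball; last first.
  move=> zx zy; apply: le_lt_trans (metric_triangle x (z k) y) _.
  by rewrite -[ltRHS](subrK (e j)) addrC ltrD// metric_sym.
move=> xy; pose j := Num.trunc (2 / (r - mdist x y)).
have [k zx] := hz x _ (e0 j); exists k => //; exists j => //; split => //=.
rewrite in_ball; move: zx; rewrite in_ball => zx.
have ej : (e j <= (r - mdist x y) / 2)%R.
  rewrite invf_ple ?posrE ?divr_gt0 ?subr_gt0//.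
  by rewrite invf_div; exact/ltW/truncnS_gt.
have tri := metric_triangle (z k) x y.
have comb (a b c f : R) : (a < f -> f <= (r - b) / 2 -> c <= a + b -> c < r - f)%R by lra.
exact: comb zx ej tri.
Qed.

Lemma measurable_ball_integral (r : R) (g : T * T -> \bar R) :
  measurable_fun [set: T * T] g -> (forall p, 0 <= g p) ->
  measurable_fun [set: T] (fun x => \int[mu]_(y in ball x r) g (x, y)).
Proof.
move=> mg g0.
pose h := g \_ [set p : T * T | ball p.1 r p.2].
have mh : measurable_fun [set: T * T] h.
  apply/(measurable_restrictT _ _).1; first exact: measurable_ball_relation.
  exact: measurable_funTS.
have h0 p : 0 <= h p by rewrite /h patchE; case: ifP.
have := @measurable_fun_fubini_tonelli_F _ _ T T R nu h mh h0.
rewrite (_ : fubini_F _ _ = (fun x => \int[mu]_(y in ball x r) g (x, y)))//.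
apply/funext => x; rewrite /fubini_F [RHS]integral_mkcond.
by apply: eq_integral => y _; rewrite /h !patchE; congr (if _ then _ else _); apply/idP/idP; rewrite !inE.
Qed.

Lemma measurable_gradient (alpha r : R) (f : T -> R) : measurable_fun [set: T] f ->
  measurable_fun [set: T] (gradient mu alpha r f).
Proof.
move=> mf; apply: measurable_fun_powR; apply: measurable_funM.
  rewrite (_ : (fun x => _) = (fun x => fine (mu (ball x r)) `^ (-1))%R); last first.
    by apply/funext => x; rewrite powR_inv1 ?fine_ge0.
  apply: measurable_fun_powR; apply: measurableT_comp => //.
  rewrite (_ : (fun x => _) = (fun x => \int[mu]_(y in ball x r) cst 1 (x, y))).
    by apply: (@measurable_ball_integral r (cst 1)).
  apply/funext => x; rewrite integral_cst ?mul1e//.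
  exact: (measurable_metric_ball mu_doubling).
apply: measurableT_comp => //.
apply: (@measurable_ball_integral r (fun p => (`|f p.1 - f p.2| `^ alpha)%:E)).
  apply/measurable_EFinP; apply: measurable_fun_powR; apply: measurableT_comp => //.
  by apply: measurable_funB; apply: measurableT_comp.
by move=> p; rewrite lee_fin powR_ge0.
Qed.

End gradient_measurability.

(** * Cone functions *)

Section cone_function.
Context (d : measure_display) (R : realType) (T : metricMeasurableType d R).
Variable mu : {measure set T -> \bar R}.
Hypothesis mu_doubling : doubling_space mu.
Hypothesis mu_infinite : mu [set: T] = +oo.
Variable alpha : R.
Hypotheses (alpha0 : (0 < alpha)%R) (alpha1 : (alpha <= 1)%R).
Variable x0 : T.

Definition cone (y : T) : R := Num.max (1 - mdist x0 y)%R 0%R.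

Let B : set T := ball x0 (1 : R).
Let m := fine (mu B).
Let D := doubling_constant mu.

Let mB : measurable B. Proof. exact: (measurable_metric_ball mu_doubling). Qed.
Let mE : mu B = m%:E. Proof. by rewrite fineK// (ball_measure_fin mu_doubling). Qed.
Let m0 : (0 < m)%R.
Proof. by rewrite -lte_fin -mE; exact: (ball_measure_gt0 mu_doubling). Qed.
Let D1 : (1 < D)%R. Proof. by have [] := doubling_constantP mu_doubling mu_infinite. Qed.
Let D0 : (0 < D)%R. Proof. exact: lt_trans D1. Qed.

Lemma cone_ge0 y : (0 <= cone y)%R. Proof. by rewrite le_max lexx orbT. Qed.

Lemma cone_le1 y : (cone y <= 1)%R.
Proof. by rewrite ge_max ler01 andbT gerBl mdist_ge0. Qed.

Lemma cone_out y : ~ B y -> cone y = 0%R.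
Proof.
by rewrite /B in_ball => /negP; rewrite -leNgt => y1; apply: max_r; rewrite subr_le0.
Qed.

Lemma cone_lipschitz y z : (`|cone y - cone z| <= mdist y z)%R.
Proof.
have t1 := metric_triangle x0 y z; have t2 := metric_triangle x0 z y.
rewrite (metric_sym z y) in t2; have d0 := mdist_ge0 y z; rewrite /cone ler_norml.
move: t1 t2 d0; move: (mdist x0 y) (mdist x0 z) (mdist y z) => a b c t1 t2 d0.
by case: (leP (1 - a)%R 0%R) => h1; case: (leP (1 - b)%R 0%R) => h2;
  apply/andP; split; lra.
Qed.

Lemma measurable_cone : measurable_fun [set: T] cone.
Proof.
apply: measurable_maxr => //; apply: measurable_funB => //.
exact: (measurable_mdist mu_doubling).
Qed.

Lemma cone_powR_le y : (`|cone y| `^ alpha <= \1_B y)%R.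
Proof.
rewrite ger0_norm ?cone_ge0// indicE; have [yB|yB] := boolP (y \in B); last first.
  by rewrite cone_out ?powR0 ?gt_eqF//; move: yB; rewrite notin_setE.
have -> : (true%:R = 1 `^ alpha :> R)%R by rewrite powR1.
by apply: le_powR; rewrite ?cone_ge0 ?cone_le1// ltW.
Qed.

Lemma cone_sum_norm : sum_space mu alpha cone /\
  sum_norm mu alpha cone <= (m `^ alpha^-1)%:E.
Proof.
have dec : sum_decomposition cone (cone, cst 0%R).
  by split => //=; [exact: measurable_cone|move=> x; rewrite addr0].
have N2 : 'N[mu]_(+oo)[EFin \o (cst 0%R : T -> R)] = 0 by exact: Lnorm0.
have N1 : 'N[mu]_(alpha%:E)[EFin \o cone] <= (m `^ alpha^-1)%:E.
  rewrite unlock -poweR_EFin; apply: gt0_ler_poweR.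
  - by rewrite invr_ge0 ltW.
  - by rewrite in_itv/= leey andbT; apply: integral_ge0 => x _; rewrite lee_fin powR_ge0.
  - by rewrite in_itv/= leey andbT lee_fin ltW.
  rewrite -mE -[B]setIT -integral_indic//; apply: le_integral_ge0 => x _.
    by rewrite /= lee_fin powR_ge0.
  by rewrite /= lee_fin cone_powR_le.
split.
  exists (cone, cst 0%R) => //; split; rewrite /finite_norm /=.
    by apply: le_lt_trans N1 _; rewrite ltry.
  by rewrite N2 ltry.
apply: (@le_trans _ _ ('N[mu]_(alpha%:E)[EFin \o cone] + 'N[mu]_(+oo)[EFin \o (cst 0%R : T -> R)])).
  by apply: ereal_inf_lbound; exists (cone, cst 0%R).
by rewrite N2 adde0.
Qed.

Lemma gradient_le_average (f : T -> R) (r : R) (y : T) (c : R) : (0 < r)%R ->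
  \int[mu]_(z in ball y r) (`|f y - f z| `^ alpha)%:E <= c%:E * mu (ball y r) ->
  (gradient mu alpha r f y <= c `^ alpha^-1)%R.
Proof.
move=> r0 fc; have b0 : (0 < fine (mu (ball y r)))%R.
  rewrite fine_gt0// (ball_measure_gt0 mu_doubling)//=.
  exact: (ball_measure_lty mu_doubling).
have I0 : 0 <= \int[mu]_(z in ball y r) (`|f y - f z| `^ alpha)%:E.
  by apply: integral_ge0 => z _; rewrite lee_fin powR_ge0.
apply: le_powR; first by rewrite invr_ge0 ltW.
  by rewrite mulr_ge0 ?invr_ge0 ?fine_ge0.
rewrite ler_pdivrMl// -lee_fin [X in X <= _]fineK; last first.
  rewrite ge0_fin_numE//; apply: le_lt_trans fc _.
  by rewrite -[mu _]fineK ?(ball_measure_fin mu_doubling)// -EFinM ltry.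
by rewrite mulrC EFinM fineK ?(ball_measure_fin mu_doubling).
Qed.

(** The cone is 1-Lipschitz, and it vanishes on the balls of radius at most 1
    centred outside B(x0, 2). *)
Lemma gradient_cone_small (r : R) (y : T) : (0 < r)%R -> (r <= 1)%R ->
  (gradient mu alpha r cone y <= r * \1_(ball x0 (2 : R)) y)%R.
Proof.
move=> r0 r1; have my := measurable_metric_ball mu_doubling y r.
pose c := ((r * \1_(ball x0 (2 : R)) y) `^ alpha)%R.
have i0 : (0 <= r * \1_(ball x0 (2 : R)) y)%R by rewrite mulr_ge0// ltW.
rewrite -[leRHS](powRK alpha0)//; apply: gradient_le_average => //.
rewrite -[leRHS](integral_cst mu my); apply: le_integral_ge0 => z; rewrite in_ball => yz.
  by rewrite lee_fin powR_ge0.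
rewrite lee_fin; apply: le_powR => //; first exact: ltW.
rewrite indicE; have [yB|yB] := boolP (y \in (ball x0 (2 : R) : set T)).
  by rewrite mulr1 (le_trans (cone_lipschitz _ _))// ltW.
have far : (2 <= mdist x0 y)%R.
  by move/negP : yB; rewrite inE in_ball leNgt => /negP.
have far' : (1 <= mdist x0 z)%R.
  have := metric_triangle x0 z y; rewrite (metric_sym z y).
  by move: yz far r1; move: (mdist x0 z) (mdist x0 y) (mdist y z) => a b e; lra.
rewrite mulr0 !cone_out ?subr0 ?normr0//= /B in_ball; apply/negP; rewrite -leNgt//.
by apply: le_trans far; rewrite ler1n.
Qed.

(** In |f y - f z|^alpha <= |f y|^alpha + |f z|^alpha the first term lives on
    B(x0, 1). The average of the second over B(y, r) is at most m / mu (B(y, r)),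
    and it is 0 unless B(y, r) meets B(x0, 1), in which case doubling compares
    mu (B(y, r)) with mu (B(x0, 2r)). *)
Lemma gradient_cone_large (r : R) (y : T) : (1 < r)%R ->
  (gradient mu alpha r cone y <=
   (\1_B y + D ^+ 2 * m / fine (mu (ball x0 (2 * r))) * \1_(ball x0 (2 * r)) y) `^ alpha^-1)%R.
Proof.
move=> r1; have r0 : (0 < r)%R := lt_trans ltr01 r1.
have my := measurable_metric_ball mu_doubling y r.
have m2 := measurable_metric_ball mu_doubling x0 (2 * r)%R.
set M := fine (mu (ball x0 (2 * r)%R)).
have ME : mu (ball x0 (2 * r)%R) = M%:E by rewrite fineK// (ball_measure_fin mu_doubling).
have M0 : (0 < M)%R.
  by rewrite -lte_fin -ME; apply: (ball_measure_gt0 mu_doubling); rewrite mulr_gt0.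
apply: gradient_le_average => //.
apply: (@le_trans _ _ (\int[mu]_(z in ball y r) ((cst (\1_B y)%:E z) + (\1_B z)%:E))).
  apply: le_integral_ge0 => z _; first by rewrite lee_fin powR_ge0.
  rewrite lee_fin; apply: (@le_trans _ _ (`|cone y| `^ alpha + `|cone z| `^ alpha)%R).
    apply: le_trans (powR_subadditive alpha0 alpha1 _ _) => //.
    by apply: le_powR => //; [exact: ltW|exact: ler_normB].
  by rewrite lerD// cone_powR_le.
rewrite ge0_integralD//; last by apply/measurable_EFinP; exact: measurable_indic.
rewrite integral_cst// integral_indic// EFinD ge0_muleDl ?lee_fin ?mulr_ge0 ?invr_ge0//.
apply: leeD => //.
have [[z [Bz yz]]|/forallNP nz] := pselect (exists z, B z /\ ball y r z); last first.
  rewrite (_ : B `&` ball y r = set0) ?measure0; last first.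
    by apply/seteqP; split => // z zz; exact: nz zz.
  by rewrite mule_ge0// lee_fin !mulr_ge0 ?invr_ge0// ltW.
have xy : (mdist x0 y < 1 + r)%R.
  apply: le_lt_trans (metric_triangle x0 z y) _; rewrite metric_sym.
  move: Bz yz; rewrite /B !in_ball (metric_sym z x0) => Bz yz; rewrite (metric_sym z y).
  exact: ltrD.
rewrite indicE mem_set ?mulr1; last first.
  by rewrite in_ball; apply: lt_trans xy _; rewrite mulr_natl mulr2n ltrD2r.
apply: (@le_trans _ _ m%:E).
  by rewrite -mE; apply: le_mu => //; exact: measurableI.
(* d(x0, y) < 1 + r < 2r, so that B(x0, 2r) lies in B(y, 4r). *)
have MD : M%:E <= (D ^+ 2)%:E * mu (ball y r).
  apply: le_trans (ball_doubling_iter mu_doubling mu_infinite y 2 r0); rewrite -ME.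
  apply: le_mu => //; first exact: (measurable_metric_ball mu_doubling).
  apply: ball_subset; rewrite metric_sym expr2.
  by move: xy r1; move: (mdist x0 y) => a; lra.
rewrite -[mu _]fineK ?(ball_measure_fin mu_doubling)// in MD *.
move: MD; rewrite -!EFinM !lee_fin => MD.
  have -> : (D ^+ 2 * m / M * fine (mu (ball y r)) =
             m * ((D ^+ 2 * fine (mu (ball y r))) / M))%R by ring.
  by rewrite ler_peMr ?(ltW m0)// ler_pdivlMr// mul1r.
- exact: ltW.
- exact: ltW.
- exact: ltW.
- exact: ltW.
by move=> z _; rewrite lee_fin.
Qed.

End cone_function.

(** * The estimate implies non-collapsing *)

Section estimate_implies_noncollapsing.
Context (d : measure_display) (R : realType) (T : metricMeasurableType d R).
Variable mu : {measure set T -> \bar R}.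
Hypothesis mu_doubling : doubling_space mu.
Hypothesis mu_infinite : mu [set: T] = +oo.
Variables (alpha : R) (X : qri_space mu).
Hypotheses (alpha0 : (0 < alpha)%R) (alpha1 : (alpha <= 1)%R).

Let D := doubling_constant mu.
Let D1 : (1 < D)%R. Proof. by have [] := doubling_constantP mu_doubling mu_infinite. Qed.
Let D0 : (0 < D)%R. Proof. exact: lt_trans D1. Qed.
Let ai0 : (0 <= alpha^-1)%R. Proof. by rewrite invr_ge0 ltW. Qed.

Let ballE (x : T) (r : R) : (0 < r)%R -> mu (ball x r) = (fine (mu (ball x r)))%:E.
Proof. by move=> r0; rewrite fineK// (ball_measure_fin mu_doubling). Qed.

Let ball_gt0 (x : T) (r : R) : (0 < r)%R -> (0 < fine (mu (ball x r)))%R.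
Proof. by move=> r0; rewrite -lte_fin -ballE// (ball_measure_gt0 mu_doubling). Qed.

Let ball_le (x : T) (r r' : R) : (0 < r)%R -> (r <= r')%R ->
  (fine (mu (ball x r)) <= fine (mu (ball x r')))%R.
Proof.
move=> r0 rr'; rewrite -lee_fin -!ballE ?(lt_le_trans r0)//.
apply: le_mu; [exact: (measurable_metric_ball mu_doubling)..|].
by apply: ball_subset; rewrite mdistxx add0r.
Qed.

Let ball_double (x : T) (r : R) : (0 < r)%R ->
  (fine (mu (ball x (2 * r))) <= D * fine (mu (ball x r)))%R.
Proof.
move=> r0; have [_ dD] := doubling_constantP mu_doubling mu_infinite.
by rewrite -lee_fin EFinM -!ballE ?mulr_gt0//; exact: dD.
Qed.

Let ball_mem (x : T) (r : R) : (0 < r)%R -> qri_mem X (\1_(ball x r)).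
Proof.
move=> r0; apply: qri_indic; first exact: (measurable_metric_ball mu_doubling).
exact: (ball_measure_lty mu_doubling).
Qed.

Let norm_ball (x : T) (r : R) : (0 < r)%R ->
  qri_norm X (\1_(ball x r)) = fundamental_fun X (fine (mu (ball x r))).
Proof.
move=> r0; apply/esym/fundamental_funE; last exact: ballE.
exact: (measurable_metric_ball mu_doubling).
Qed.

(** The rearrangement of the alpha-th power of the cone vanishes at m but exceeds
    2^-alpha below mu (B(x0, 1/2)), which is at least m / D. *)
Lemma oscillation_cone_ge (x0 : T) :
  (D^-1 * 2^-1 `^ alpha)%:E <=
  oscillation mu (fun x => `|cone x0 x| `^ alpha)%R (fine (mu (ball x0 (1 : R)))).
Proof.
set m := fine _; set g := (fun x => _)%R; have m0 : (0 < m)%R by exact: ball_gt0.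
have mg : measurable_fun [set: T] g.
  apply: measurable_fun_powR; apply: measurableT_comp => //.
  exact: (measurable_cone mu_doubling).
have c0 : (0 <= (2^-1 : R) `^ alpha)%R by exact: powR_ge0.
have -> : oscillation mu g m = maximal_rearrangement mu g m.
  rewrite /oscillation (_ : rearrangement mu g m = 0) ?sube0//.
  apply/eqP; rewrite eq_le rearrangement_ge0 andbT; apply: ereal_inf_lbound.
  exists 0%R => //; split => //; rewrite -ballE//; apply: le_mu.
  - exact: measurable_superlevel.
  - exact: (measurable_metric_ball mu_doubling).
  - move=> x /=; apply: contraPP => xB; rewrite /g (cone_out xB) normr0.
    by rewrite powR0 ?gt_eqF// normr0 ltxx.
rewrite /maximal_rearrangement.
have mD : (m / D <= m)%R by rewrite ler_pdivrMr// ler_peMr ?(ltW m0) ?(ltW D1).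
apply: (@le_trans _ _ ((m^-1)%:E * \int[lebesgue_measure]_(u in `]0%R, (m / D)%R[)
    (cst (2^-1 `^ alpha)%:E u))).
  rewrite integral_cst//= lebesgue_measure_itv/= lte_fin divr_gt0// sube0 -!EFinM.
  rewrite lee_fin le_eqVlt; apply/orP; left; apply/eqP.
  by field; rewrite !gt_eqF.
apply: lee_wpmul2l; first by rewrite lee_fin invr_ge0 ltW.
rewrite integral_mkcond [leRHS]integral_mkcond; apply: le_integral_ge0 => u _.
  by rewrite patchE; case: ifP => // _; rewrite lee_fin.
rewrite !patchE; case: ifPn => [|_]; last first.
  by case: ifP => // _; exact: rearrangement_ge0.
rewrite inE /= in_itv/= => /andP[u0 uD].
rewrite mem_set ?rearrangement_gtP// /= ?in_itv/= ?u0 ?(lt_le_trans uD)//.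
apply: ltW; rewrite rearrangement_gtP//.
apply: (@lt_le_trans _ _ (fine (mu (ball x0 (2^-1 : R))))%:E).
  rewrite lte_fin; apply: lt_le_trans uD _; rewrite ler_pdivrMr// mulrC.
  by apply: le_trans (ball_double _ _) => //; rewrite mulfV.
rewrite -ballE//; apply: le_mu; first exact: (measurable_metric_ball mu_doubling).
  exact: measurable_superlevel.
move=> x; rewrite in_ball => xB; rewrite /= /g !ger0_norm ?powR_ge0 ?cone_ge0//.
apply: gt0_ltr_powR; rewrite ?nnegrE ?cone_ge0// lt_max; apply/orP; left.
by move: xB; move: (mdist x0 x) => a; lra.
Qed.

Hypothesis mu_point : forall x : T, mu [set x] = 0.
Variables (C : R).
Hypothesis C0 : (0 < C)%R.
Hypothesis convexC : forall (n : nat) (f : 'I_n -> T -> R),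
  (forall j, qri_mem X (f j)) ->
  qri_enorm X (fun x => (\sum_(j < n) `|f j x| `^ alpha) `^ alpha^-1)%R <=
  (C * (\sum_(j < n) qri_norm X (f j) `^ alpha) `^ alpha^-1)%R%:E.

Let phi := fundamental_fun X.

(** B(x0, 2) has measure at most D m, and phi (D m) is comparable to phi m. *)
Lemma besov_modulus_cone_small (x0 : T) (r : R) : (0 < r)%R -> (r <= 1)%R ->
  besov_modulus alpha X (cone x0) r <=
  (r * (C * (2 * D) `^ alpha^-1 * phi (fine (mu (ball x0 (1 : R))))))%:E.
Proof.
move=> r0 r1; set m := fine _; have m0 : (0 < m)%R by exact: ball_gt0.
have [Psi mPsi PsiE] := exists_uniform_map mu_doubling mu_infinite mu_point.
have r02 : (0 < 2 :> R)%R by [].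
have [||Xg leg] := @qri_ideal _ _ _ _ X (gradient mu alpha r (cone x0))
  (fun y => r * \1_(ball x0 (2 : R)) y)%R _ _ (qri_memZ r (ball_mem x0 r02)).
- apply: (measurable_gradient mu_doubling mu_infinite).
  exact: (measurable_cone mu_doubling).
- move=> y; rewrite (gradient_ge0 _ _ _ _ y)/=.
  exact: (gradient_cone_small mu_doubling).
rewrite /besov_modulus qri_enormE// lee_fin; apply: le_trans leg _.
rewrite qri_normZ ?(ltW r0)//; last exact: ball_mem.
rewrite ger0_norm ?(ltW r0)// ler_pM2l// norm_ball//.
set M := fine _; have mM : (m <= M)%R by apply: ball_le => //; rewrite ler1n.
have MD : (M <= D * m)%R by have := ball_double x0 ltr01; rewrite mulr1.
apply: le_trans (fundamental_fun_quasiconcave mPsi PsiE alpha0 C0 convexC m0 mM) _.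
rewrite -mulrA ler_pM2l// ler_wpM2r ?fundamental_fun_nonneg//.
apply: le_powR => //; first by rewrite mulr_ge0// divr_ge0// fine_ge0.
by rewrite ler_pM2l// ler_pdivrMr.
Qed.

(** By alpha-convexity the quasi-norm is controlled by phi m and by the size
    (D^2 m / M)^(1/alpha) * phi M of the spread-out part, where M is the measure of
    B(x0, 2r); the almost monotonicity of phi(t)^alpha / t makes the latter
    comparable to phi m uniformly in r. *)
Lemma besov_modulus_cone_large (x0 : T) (r : R) : (1 < r)%R ->
  besov_modulus alpha X (cone x0) r <=
  (C * (1 + 2 * D ^+ 2 * C `^ alpha) `^ alpha^-1 *
   phi (fine (mu (ball x0 (1 : R)))))%:E.
Proof.
move=> r1; set m := fine _; have m0 : (0 < m)%R by exact: ball_gt0.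
have [Psi mPsi PsiE] := exists_uniform_map mu_doubling mu_infinite mu_point.
have r0 : (0 < 2 * r)%R by rewrite mulr_gt0// (lt_trans ltr01).
pose M := fine (mu (ball x0 (2 * r)%R)); have M0 : (0 < M)%R by exact: ball_gt0.
have mM : (m <= M)%R.
  apply: ball_le => //; apply: (le_trans (ltW r1)).
  by rewrite ler_peMl ?ler1n// ltW// (lt_trans ltr01).
have phi0 t : (0 <= phi t)%R by exact: fundamental_fun_nonneg.
pose c := (D ^+ 2 * m / M)%R.
have c0 : (0 < c)%R by rewrite divr_gt0// mulr_gt0// exprn_gt0.
pose f (j : 'I_2) : T -> R := if j == ord0 then \1_(ball x0 (1 : R))
  else (fun y => c `^ alpha^-1 * \1_(ball x0 (2 * r)) y)%R.
have Xf j : qri_mem X (f j).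
  by rewrite /f; case: ifP => _; [exact: ball_mem|apply: qri_memZ; exact: ball_mem].
have ind_powR (E : set T) (y : T) : (`|\1_E y : R| `^ alpha = \1_E y :> R)%R.
  rewrite indicE; case: (y \in E); rewrite ?normr1 ?powR1//.
  by rewrite normr0 powR0// gt_eqF.
have := convexC Xf; rewrite !big_ord_recl big_ord0 addr0 /=.
set F := (fun x => _)%R.
have FE y : F y = ((\1_(ball x0 (1 : R)) y + c * \1_(ball x0 (2 * r)) y) `^ alpha^-1)%R.
  rewrite /F !big_ord_recl big_ord0 addr0 /f /= ind_powR normrM powRM// ind_powR.
  by rewrite ger0_norm ?powR_ge0// powRVK// ltW.
rewrite {1}/qri_enorm; case: ifPn => [XF|_]; last by rewrite leye_eq.
move: XF => /set_mem XF; rewrite lee_fin => leF.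
have [||Xg leg] := @qri_ideal _ _ _ _ X (gradient mu alpha r (cone x0)) F _ _ XF.
- apply: (measurable_gradient mu_doubling mu_infinite).
  exact: (measurable_cone mu_doubling).
- move=> y; rewrite (gradient_ge0 _ _ _ _ y)/= FE.
  exact: (gradient_cone_large mu_doubling mu_infinite).
rewrite /besov_modulus qri_enormE// lee_fin; apply: le_trans leg _; apply: le_trans leF _.
have K0 : (0 <= 1 + 2 * D ^+ 2 * C `^ alpha)%R.
  apply: addr_ge0 => //; apply: mulr_ge0; last exact: powR_ge0.
  by apply: mulr_ge0 => //; apply: exprn_ge0; exact: ltW.
rewrite -[leRHS]mulrA ler_pM2l// -[X in (_ <= _ * X)%R](powRK alpha0)//.
rewrite -(powRM _ K0 (powR_ge0 _ _)).
apply: le_powR => //; first by rewrite addr_ge0// powR_ge0.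
rewrite {1}/f /= norm_ball// mulrDl mul1r lerD//.
rewrite {1}/f /= qri_normZ; last exact: ball_mem.
rewrite norm_ball// -/M -/phi ger0_norm; last exact: powR_ge0.
rewrite (powRM _ (powR_ge0 _ _) (phi0 M)) (powRVK alpha0 (ltW c0)).
have := fundamental_fun_quasiconcave mPsi PsiE alpha0 C0 convexC m0 mM.
move=> /(le_powR (ltW alpha0) (phi0 M)).
have Mm0 : (0 <= 2 * (M / m))%R by rewrite mulr_ge0// divr_ge0// ltW.
rewrite (powRM _ (ltW C0) (mulr_ge0 (powR_ge0 _ _) (phi0 m))).
rewrite (powRM _ (powR_ge0 _ _) (phi0 m)) (powRVK alpha0 Mm0).
move=> /(ler_wpM2l (ltW c0)) /le_trans; apply.
rewrite le_eqVlt; apply/orP; left; apply/eqP; rewrite /c.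
by field; rewrite !gt_eqF.
Qed.

Lemma besov_seminorm_cone_le (x0 : T) (s : R) : (0 < s)%R -> (s < 1)%R ->
  besov_seminorm alpha X s +oo (cone x0) <=
  ((C * (2 * D) `^ alpha^-1 + C * (1 + 2 * D ^+ 2 * C `^ alpha) `^ alpha^-1) *
   phi (fine (mu (ball x0 (1 : R)))))%:E.
Proof.
move=> s0 s1; apply: ge_ereal_sup => _ [r /= + <-]; rewrite in_itv/= andbT => r0.
have small := @besov_modulus_cone_small x0 r r0.
have large := @besov_modulus_cone_large x0 r.
move: small large; set A := (C * _ `^ _)%R; set B := (C * _ `^ _)%R => small large.
have A0 : (0 <= A)%R by rewrite mulr_ge0 ?powR_ge0// ltW.
have B0 : (0 <= B)%R by rewrite mulr_ge0 ?powR_ge0// ltW.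
move: small large; set F := phi _ => small large.
have F0 : (0 <= F)%R by exact: fundamental_fun_nonneg.
have [r1|r1] := leP r 1%R.
  apply: (@le_trans _ _ ((r `^ (- s))%:E * (r * (A * F))%:E)).
    by apply: lee_wpmul2l; [rewrite lee_fin powR_ge0|exact: small].
  rewrite -EFinM lee_fin; apply: (@le_trans _ _ (A * F)%R); last first.
    by rewrite ler_wpM2r// lerDl.
  rewrite [leLHS]mulrA; apply: ler_piMl; first exact: mulr_ge0.
  rewrite -[X in (_ * X)%R](powRr1 (ltW r0)) -powRD; last by rewrite (gt_eqF r0) implybT.
  rewrite -[leRHS](powRr0 r).
  apply: ger_powR; first by rewrite r0.
  by rewrite addrC subr_ge0 ltW.
apply: (@le_trans _ _ (1 * besov_modulus alpha X (cone x0) r)).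
  apply: lee_wpmul2r; first exact: besov_modulus_ge0.
  rewrite lee_fin powRN invf_le1 ?powR_gt0//.
  rewrite -[leLHS](powRr0 r).
  by apply: ler_powR; exact: ltW.
rewrite mul1e; apply: le_trans (large r1) _.
by rewrite lee_fin ler_wpM2r// lerDr.
Qed.

(** If m = mu (B(x0, 1)) < 1, then testing on the cone and evaluating the supremum
    at t = m bounds phi m / m^(s/Q) by a multiple of phi m: the norm of the cone in
    the sum space, at most m^(1/alpha), is itself at most a multiple of phi m. This
    bounds m from below. *)
Lemma estimate_noncollapsing (s K : R) : (0 < s)%R -> (s < 1)%R -> (0 < K)%R ->
  (forall f : T -> R, sum_space mu alpha f ->
     Lq_dt_over_t +oo `]0%R, 1%R[
       (fun t => oscillation mu (fun x => `|f x| `^ alpha)%R t `^ alpha^-1 *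
                 (phi t / t `^ (s / upper_dimension mu))%R%:E)
     <= K%:E * (besov_seminorm alpha X s +oo f + sum_norm mu alpha f)) ->
  non_collapsing mu.
Proof.
move=> s0 s1 K0 estimate.
have [Psi mPsi PsiE] := exists_uniform_map mu_doubling mu_infinite mu_point.
have phi_gt0 := fundamental_fun_gt0 mPsi PsiE X.
pose p := (s / upper_dimension mu)%R.
have p0 : (0 < p)%R.
  by rewrite divr_gt0// (upper_dimension_gt0 mu_doubling mu_infinite).
pose a := ((D^-1 * 2^-1 `^ alpha) `^ alpha^-1)%R.
have a0 : (0 < a)%R by rewrite powR_gt0// mulr_gt0 ?invr_gt0// powR_gt0.
pose A := (C * (2 * D) `^ alpha^-1 + C * (1 + 2 * D ^+ 2 * C `^ alpha) `^ alpha^-1)%R.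
have A0 : (0 <= A)%R by apply: addr_ge0; rewrite mulr_ge0 ?powR_ge0// ltW.
pose B := (C * 2 `^ alpha^-1 / phi 1)%R.
have B0 : (0 < B)%R by rewrite divr_gt0 ?phi_gt0// mulr_gt0// powR_gt0.
pose G := (K * (A + B))%R.
have G0 : (0 < G)%R by rewrite mulr_gt0// ltr_wpDl.
pose e := ((a / G) `^ p^-1)%R.
have e0 : (0 < e)%R by rewrite powR_gt0// divr_gt0.
have lower (x0 : T) : (Num.min 1 e <= fine (mu (ball x0 (1 : R))))%R.
  set m := fine _; have m0 : (0 < m)%R by exact: ball_gt0.
  rewrite ge_min; apply/orP; have [m1|m1] := leP 1%R m; [by left|right].
  have F0 := phi_gt0 m m0.
  have [fsum leN] := cone_sum_norm mu_doubling alpha0 x0.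
  have mp0 : (0 < m `^ p)%R by exact: powR_gt0.
  suff h : (a * (phi m / m `^ p) <= K * (A * phi m + m `^ alpha^-1))%R.
    have mB : (m `^ alpha^-1 <= B * phi m)%R.
      have -> : (B * phi m = C * 2 `^ alpha^-1 * phi m / phi 1)%R by rewrite /B mulrAC.
      rewrite ler_pdivlMr ?phi_gt0//.
      have := fundamental_fun_quasiconcave mPsi PsiE alpha0 C0 convexC m0 (ltW m1).
      rewrite -/phi div1r powRM ?invr_ge0 ?(ltW m0)// powR_inv ?(ltW m0)//.
      have ma0 : (0 < m `^ alpha^-1)%R by exact: powR_gt0.
      move=> /(ler_wpM2l (ltW ma0)) /le_trans; apply.
      rewrite le_eqVlt; apply/orP; left; apply/eqP.
      by field; rewrite gt_eqF.
    have aG : (a / m `^ p <= G)%R.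
      rewrite -(ler_pM2r F0) -mulrA [(_^-1 * _)%R]mulrC; apply: (le_trans h).
      by rewrite /G -mulrA ler_pM2l// [leRHS]mulrDl lerD2l.
    rewrite /e -[leRHS](powRK p0 (ltW m0)); apply: le_powR.
    - by rewrite invr_ge0 ltW.
    - by rewrite ltW// divr_gt0.
    - by rewrite ler_pdivrMr// mulrC -ler_pdivrMr.
  rewrite -lee_fin EFinM.
  apply: (@le_trans _ _ (oscillation mu (fun x => `|cone x0 x| `^ alpha)%R m `^ alpha^-1 *
      (phi m / m `^ p)%R%:E)).
    apply: lee_wpmul2r; first by rewrite lee_fin divr_ge0// ltW.
    rewrite /a -poweR_EFin; apply: gt0_ler_poweR => //.
    - by rewrite in_itv/= leey andbT lee_fin mulr_ge0 ?powR_ge0// invr_ge0 ltW.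
    - rewrite in_itv/= leey andbT; apply: le_trans (oscillation_cone_ge x0).
      by rewrite lee_fin mulr_ge0 ?powR_ge0// invr_ge0 ltW.
    - exact: oscillation_cone_ge.
  apply: le_trans (_ : _ <= K%:E * (besov_seminorm alpha X s +oo (cone x0) +
    sum_norm mu alpha (cone x0))) _.
    apply: le_trans (estimate _ fsum); apply: ereal_sup_ubound.
    by exists m => //; rewrite /= in_itv/= m0.
  rewrite EFinM; apply: lee_wpmul2l; first by rewrite lee_fin ltW.
  by rewrite EFinD; apply: leeD => //; exact: besov_seminorm_cone_le.
set I := ereal_inf [set mu (ball x 1%R) | x in [set: T]].
have Ige : (Num.min 1 e)%:E <= I.
  by apply: le_ereal_inf_tmp => _ [x _ <-]; rewrite ballE// lee_fin.
have Ile : I < +oo.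
  have [[x _]|T0] := pselect ([set: T] !=set0); last first.
    have := mu_infinite; rewrite (_ : [set: T] = set0) ?measure0//.
    by apply/seteqP; split => // x xT; case: T0; exists x.
  apply: le_lt_trans (ball_measure_lty mu_doubling x ltr01).
  by apply: ereal_inf_lbound; exists x.
have min0 : (0 < Num.min 1 e)%R by rewrite lt_min ltr01.
have Ifin : I = (fine I)%:E.
  by rewrite fineK// ge0_fin_numE//; apply: le_trans Ige; rewrite lee_fin ltW.
by exists (fine I) => //; apply: (lt_le_trans min0); rewrite -lee_fin -Ifin.
Qed.

End estimate_implies_noncollapsing.

(** * The equivalence *)

Theorem theorem6 (d : measure_display) (R : realType)
    (T : metricMeasurableType d R) (mu : {measure set T -> \bar R})
    (mu_doubling : doubling_space mu)
    (mu_infinite : mu [set: T] = +oo)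
    (mu_point : forall x : T, mu [set x] = 0)
    (alpha : R) (alpha_gt0 : (0 < alpha)%R) (alpha_le1 : (alpha <= 1)%R)
    (X : qri_space mu) (X_convex : alpha_convex X alpha) :
  non_collapsing mu <->
  (forall q : \bar R, 0 < q ->
   exists2 C : R, (0 < C)%R &
   forall s : R, (0 < s)%R -> (s < 1)%R ->
   forall f : T -> R, sum_space mu alpha f ->
     Lq_dt_over_t q `]0%R, 1%R[
       (fun t => oscillation mu (fun x => `|f x| `^ alpha)%R t `^ alpha^-1 *
                 (fundamental_fun X t / t `^ (s / upper_dimension mu))%R%:E)
     <= C%:E * (besov_seminorm alpha X s q f + sum_norm mu alpha f)).
Proof.
split=> [collapse|estimate].
  exact: (noncollapsing_estimate mu_doubling mu_infinite mu_point).
have [C C0 convexC] := X_convex.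
have [K K0 estK] := estimate +oo (ltry 0).
have s0 : (0 < 2^-1 :> R)%R by [].
have s1 : (2^-1 < 1 :> R)%R by rewrite invf_lt1// ltr1n.
exact: (estimate_noncollapsing mu_doubling mu_infinite alpha_gt0 alpha_le1 mu_point
  C0 convexC s0 s1 K0 (estK _ s0 s1)).
Qed.
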